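(* A commutative ring $A$ is a local object for the $(Hens^o,indEt^o)$ factorisation system on $CRings^o$ if and only if it is a strictly henselian local ring.
   Context: $CRings$ is the category of commutative unital rings. $Et^f$ is the class of etale ring maps (flat and unramified) of finite presentation and $Et^f_*$ the class of etale maps between rings of finite presentation over $\mathbb{Z}$. $Hens$ is the class of ring maps having the unique right lifting property with respect to $Et^f_*$, and $indEt$ is the class of maps having the unique left lifting property with respect to $Hens$; $(indEt,Hens)$ is a unique factorisation system on $CRings$ (left class $indEt$), viewed as $(Hens^o,indEt^o)$ on the opposite category. The finitely presented maps in $indEt$ are those of $Et^f$. A ring $K$ is a point of this system if $K\ne0$ and every map $K\to B$ in $Et^f$ with $B\neq 0$ admits a retraction. A point covering family of $A$ is a family $\{A\to A_i\}$ of maps in $Et^f$ such that every ring map $A\to K$ with $K$ a point factors through some $A\to A_i$. $A$ is a local object if for every point covering family $\{A\to A_i\}$ of $A$, at least one $A\to A_i$ admits a retraction. A local ring $(A,m)$ is henselian if every etale map $A\to B$ for which there is a maximal ideal $n$ of $B$ over $m$ with the same residue field has a retraction; it is strictly henselian if moreover $A/m$ is separably closed. *)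

(* Defs.v *)
From mathcomp Require Import all_boot all_order all_algebra all_field.

Set Implicit Arguments.
Unset Strict Implicit.
Unset Printing Implicit Defensive.

Import GRing.Theory.
Local Open Scope ring_scope.

(* A commutative unital ring is a [comPzRingType]: the zero ring is a ring. *)

Definition surjective (S T : Type) (f : S -> T) : Prop :=
  forall y, exists x, f x = y.

(* [B] is regarded as an [A]-module through [phi]. *)
Definition balanced_bilinear (A B : comPzRingType) (phi : {rmorphism A -> B})
    (M T : lmodType A) (t : M -> B -> T) : Prop :=
  [/\ forall m m' b, t (m + m') b = t m b + t m' b,
      forall m b b', t m (b + b') = t m b + t m b',
      forall a m b, t (a *: m) b = a *: t m b
    & forall a m b, t m (phi a * b) = a *: t m b].

(* [t] exhibits [T] as the tensor product of [M] and [B] over [A]. *)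
Definition is_tensor_product (A B : comPzRingType) (phi : {rmorphism A -> B})
    (M T : lmodType A) (t : M -> B -> T) : Prop :=
  balanced_bilinear phi t /\
  forall (P : lmodType A) (beta : M -> B -> P), balanced_bilinear phi beta ->
    (exists g : {linear T -> P}, forall m b, g (t m b) = beta m b) /\
    (forall g g' : {linear T -> P},
       (forall m b, g (t m b) = beta m b) ->
       (forall m b, g' (t m b) = beta m b) -> g =1 g').

Definition flat (A B : comPzRingType) (phi : {rmorphism A -> B}) : Prop :=
  forall (M N : lmodType A) (u : {linear M -> N}), injective u ->
  forall (TM TN : lmodType A) (tM : M -> B -> TM) (tN : N -> B -> TN),
    is_tensor_product phi tM -> is_tensor_product phi tN ->
  forall uB : {linear TM -> TN},
    (forall m b, uB (tM m b) = tN (u m) b) -> injective uB.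

(* EGA IV 17.1.1: an [A]-algebra map from [B] to the quotient of an
   [A]-algebra [C] by an ideal of square zero has at most one lift to [C]. *)
Definition formally_unramified (A B : comPzRingType)
    (phi : {rmorphism A -> B}) : Prop :=
  forall (C D : comPzRingType) (p : {rmorphism C -> D}), surjective p ->
    (forall x y, p x = 0 -> p y = 0 -> x * y = 0) ->
  forall g h : {rmorphism B -> C},
    (forall a, g (phi a) = h (phi a)) ->
    (forall b, p (g b) = p (h b)) -> g =1 h.

(* [P], with [iota] and the indeterminates [X], is the polynomial ring over
   [A] in [n] variables. The universal property is used because {poly _} and
   {mpoly _} exclude the zero ring of coefficients. *)
Definition is_polynomial_ring (A : comPzRingType) (n : nat)
    (P : comPzRingType) (iota : {rmorphism A -> P}) (X : 'I_n -> P) : Prop :=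
  forall (C : comPzRingType) (psi : {rmorphism A -> C}) (c : 'I_n -> C),
    (exists g : {rmorphism P -> C},
       (forall a, g (iota a) = psi a) /\ (forall i, g (X i) = c i)) /\
    (forall g g' : {rmorphism P -> C},
       (forall a, g (iota a) = g' (iota a)) ->
       (forall i, g (X i) = g' (X i)) -> g =1 g').

Definition finitely_presented (A B : comPzRingType)
    (phi : {rmorphism A -> B}) : Prop :=
  exists (n : nat) (P : comPzRingType) (iota : {rmorphism A -> P})
         (X : 'I_n -> P) (q : {rmorphism P -> B}),
    [/\ is_polynomial_ring iota X, forall a, q (iota a) = phi a, surjective q
      & exists (m : nat) (f : 'I_m -> P), forall y, q y = 0 <->
          exists c : 'I_m -> P, y = \sum_(j < m) c j * f j].

Definition etale (A B : comPzRingType) (phi : {rmorphism A -> B}) : Prop :=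
  [/\ flat phi, formally_unramified phi & finitely_presented phi].

(* For a factorisation system (Right^o, Left^o) on the opposite category,
   [W] stands for the class of finitely presented maps of Left. For the system
   (Hens^o, indEt^o) this class is Et^f, i.e., [etale]. *)
Definition class_of_maps : Type :=
  forall A B : comPzRingType, {rmorphism A -> B} -> Prop.

Definition admits_retraction (A B : comPzRingType)
    (phi : {rmorphism A -> B}) : Prop :=
  exists r : {rmorphism B -> A}, cancel phi r.

Definition is_point (W : class_of_maps) (K : comPzRingType) : Prop :=
  (1 : K) <> 0 /\
  forall (B : comPzRingType) (phi : {rmorphism K -> B}),
    W K B phi -> (1 : B) <> 0 -> admits_retraction phi.

Definition point_covering_family (W : class_of_maps) (A : comPzRingType)
    (I : Type) (A_ : I -> comPzRingType)
    (f : forall i, {rmorphism A -> A_ i}) : Prop :=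
  (forall i, W A (A_ i) (f i)) /\
  forall (K : comPzRingType) (u : {rmorphism A -> K}), is_point W K ->
    exists (i : I) (v : {rmorphism A_ i -> K}), forall a, v (f i a) = u a.

Definition local_object (W : class_of_maps) (A : comPzRingType) : Prop :=
  forall (I : Type) (A_ : I -> comPzRingType)
         (f : forall i, {rmorphism A -> A_ i}),
    point_covering_family W f -> exists i, admits_retraction (f i).

Definition is_ideal (A : comPzRingType) (I : A -> Prop) : Prop :=
  [/\ I 0, forall x y, I x -> I y -> I (x + y)
    & forall a x, I x -> I (a * x)].

Definition maximal_ideal (A : comPzRingType) (I : A -> Prop) : Prop :=
  [/\ is_ideal I, ~ I 1
    & forall J : A -> Prop, is_ideal J -> ~ J 1 ->
        (forall x, I x -> J x) -> forall x, J x -> I x].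

Definition local_ring (A : comPzRingType) (m : A -> Prop) : Prop :=
  maximal_ideal m /\
  forall m' : A -> Prop, maximal_ideal m' -> forall x, m' x <-> m x.

Definition lies_over (A B : comPzRingType) (phi : {rmorphism A -> B})
    (m : A -> Prop) (n : B -> Prop) : Prop :=
  forall a, n (phi a) <-> m a.

(* When [n] lies over [m], the induced map from A/m to B/n is injective; it is
   an isomorphism iff it is surjective. *)
Definition same_residue_field (A B : comPzRingType) (phi : {rmorphism A -> B})
    (n : B -> Prop) : Prop :=
  forall b, exists a, n (b - phi a).

Definition henselian (A : comPzRingType) (m : A -> Prop) : Prop :=
  local_ring m /\
  forall (B : comPzRingType) (phi : {rmorphism A -> B}), etale phi ->
    (exists n : B -> Prop,
       [/\ maximal_ideal n, lies_over phi m n & same_residue_field phi n]) ->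
    admits_retraction phi.

(* [separable_poly p] says that [p] is coprime to its derivative. *)
Definition separably_closed (k : fieldType) : Prop :=
  forall p : {poly k}, separable_poly p -> (1 < size p)%N ->
    exists x, root p x.

(* [pi] exhibits [k] as the quotient ring A/m. *)
Definition is_residue_field (A : comPzRingType) (m : A -> Prop)
    (k : fieldType) (pi : {rmorphism A -> k}) : Prop :=
  surjective pi /\ forall a, pi a = 0 <-> m a.

Definition strictly_henselian (A : comPzRingType) (m : A -> Prop) : Prop :=
  henselian m /\
  exists (k : fieldType) (pi : {rmorphism A -> k}),
    is_residue_field m pi /\ separably_closed k.

(* Main.v *)
Require Import Defs.
From HB Require Import structures.
From mathcomp Require Import all_boot all_order all_algebra all_field.
From mathcomp Require Import generic_quotient boolp classical_sets functions.

(** The theorem is a dictionary between points and separably closed fields.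

    Suppose that A is strictly henselian with residue field k. The field k is
    a point, so any point covering family of A contains a map A -> A_i through
    which A -> k factors; the kernel of A_i -> k is a maximal ideal over m with
    residue field k, and the henselian property yields a retraction. The
    substance is that k is a point ([separably_closed_point]). Let B be a
    nonzero etale k-algebra, L its quotient by a maximal ideal and T the ring
    L (x)_k L with multiplication mu : T -> L. As L is unramified and generated
    by finitely many x_h over k, the kernel J of mu is generated by the
    x_h (x) 1 - 1 (x) x_h and J = J^2, so the determinant trick gives e in T
    with mu e = 1 and e J = 0. Contracting e with a linear form on the second
    factor shows that L is finite over k, hence algebraic, and as k is
    separably closed, each x (x) 1 - 1 (x) x is nilpotent (L is purely
    inseparable). So 1 - e, which lies in J, is both nilpotent and idempotent,
    whence e = 1, J = 0 and finally L = k.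

    Conversely let A be a local object; each property of A follows from a
    suitable point covering family. The empty family shows that A is nonzero.
    The localizations at a and at 1 - a cover A, since every element of a point
    is invertible or nilpotent; hence a or 1 - a is invertible and A is local.
    For the rest, add to one etale map A -> B all localizations at elements of
    the maximal ideal m. None of the latter has a retraction, and they take
    care of the points K in which some element of m becomes invertible. In the
    other points m becomes nilpotent, and A -> K factors through B as soon as
    K (x)_A B is nonzero, because that ring is etale over K. So A -> B has a
    retraction if all these tensor products are nonzero
    ([local_object_retraction]). For an etale map to which the henselian
    property should apply, K (x)_A B maps to K modulo its nilradical. To find a
    root of a separable monic polynomial over A/m, lift it to a monic P over A
    and take B = A[X]/(P) with P' inverted; a retraction is a root of P.

    The converse needs explicit etale maps: localizations and A[X]/(P)[1/P'] are
    instances of [ex_std_etale], and etale maps are stable under base change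
    ([etale_base_change]). Flatness is handled through [flatP], which replaces
    the tensor products of modules by lists of pairs and a vanishing criterion
    for them. *)

Set Implicit Arguments.
Unset Strict Implicit.
Unset Printing Implicit Defensive.
Import GRing.Theory Pdiv.CommonRing Pdiv.RingMonic.
Local Open Scope ring_scope.
Local Open Scope quotient_scope.

(** * Quotients by undecidable congruences *)

Lemma surjective_section (S T : Type) (f : S -> T) :
  surjective f -> exists s : T -> S, cancel s f.
Proof. by move=> sf; exists (fun y => projT1 (cid (sf y))) => y; case: cid. Qed.

(** Ideals and the relations of a tensor product are undecidable propositions,
    so the congruence is made boolean by excluded middle; the operations of the
    quotient are computed on the representatives given by a section. *)
Lemma ex_zmod_quotient (T : choiceType) (e : T -> T -> Prop)
    (zero : T) (opp : T -> T) (add : T -> T -> T) :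
    (forall x, e x x) -> (forall x y, e x y -> e y x) ->
    (forall x y z, e x y -> e y z -> e x z) ->
    (forall x x', e x x' -> e (opp x) (opp x')) ->
    (forall x x' y y', e x x' -> e y y' -> e (add x y) (add x' y')) ->
    (forall x y z, e (add x (add y z)) (add (add x y) z)) ->
    (forall x y, e (add x y) (add y x)) ->
    (forall x, e (add zero x) x) ->
    (forall x, e (add (opp x) x) zero) ->
  exists (V : zmodType) (p : T -> V),
    [/\ surjective p, forall x y, p x = p y <-> e x y, p zero = 0,
        forall x y, p (add x y) = p x + p y & forall x, p (opp x) = - p x].
Proof.
move=> refl sym trans oppE addE addA addC add0 addN.
pose r x y := `[< e x y >].
have r_equiv : equiv_class_of r.
  split=> [x|x y|y x z /asboolP xy /asboolP yz]; first exact/asboolP.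
  - by apply/asboolP/asboolP; exact: sym.
  - by apply/asboolP; exact: trans xy yz.
pose E := EquivRelPack r_equiv.
pose Q := {eq_quot E}%qT.
pose p (x : T) : Q := \pi_Q x.
have surj_p : surjective p by move=> q; exists (repr q); rewrite /p reprK.
have pE x y : p x = p y <-> e x y.
  by split=> [/eqmodP/asboolP|xy] //; apply/eqmodP/asboolP.
have [s sK] := surjective_section surj_p.
have es x : e (s (p x)) x by apply/pE.
pose qadd (x y : Q) := p (add (s x) (s y)).
pose qopp (x : Q) := p (opp (s x)).
have qaddE x y : qadd (p x) (p y) = p (add x y).
  by apply/pE/addE.
have qoppE x : qopp (p x) = p (opp x) by apply/pE/oppE.
have qaddA : associative qadd.
  move=> x y z; rewrite -(sK x) -(sK y) -(sK z) !qaddE; exact/pE.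
have qaddC : commutative qadd.
  by move=> x y; rewrite -(sK x) -(sK y) !qaddE; exact/pE.
have qadd0 : left_id (p zero) qadd.
  by move=> x; rewrite -(sK x) !qaddE; exact/pE.
have qaddN : left_inverse (p zero) qopp qadd.
  by move=> x; rewrite -(sK x) qoppE qaddE; exact/pE.
pose m := GRing.isZmodule.Build Q qaddA qaddC qadd0 qaddN.
pose V : zmodType := HB.pack Q m.
by exists V, p; split=> // [x y|x]; rewrite ?[RHS]qaddE ?[RHS]qoppE.
Qed.

(** The new structure lives on the carrier of V and f is the identity; only
    the equations that f satisfies are kept, so that V and R are not confused
    by conversion. *)
Lemma ex_comPzRing_on (V : zmodType) (one : V) (mul : V -> V -> V) :
    associative mul -> commutative mul -> left_id one mul ->
    left_distributive mul +%R ->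
  exists (R : comPzRingType) (f : {additive V -> R}),
    [/\ bijective f, f one = 1 & forall x y, f (mul x y) = f x * f y].
Proof.
(* The class of V must be exposed to unify with the one of the carrier. *)
case: V one mul => T cls one mul mulA mulC mul1 mulD.
pose V := GRing.Zmodule.Pack cls.
pose m := GRing.Zmodule_isComPzRing.Build (GRing.Zmodule.sort V)
  mulA mulC mul1 mulD.
pose R : comPzRingType := HB.pack (GRing.Zmodule.sort V) m.
have fB : zmod_morphism (fun x : V => x : R) by [].
pose f : {additive V -> R} := HB.pack (fun x : V => x : R)
  (GRing.isZmodMorphism.Build V R (fun x : V => x : R) fB).
by exists R, f; split=> //; exists id.
Qed.

Lemma ex_lmod_on (R : pzRingType) (V : zmodType) (scale : R -> V -> V) :
    (forall a b v, scale a (scale b v) = scale (a * b) v) ->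
    left_id 1 scale -> right_distributive scale +%R ->
    (forall v, {morph scale^~ v : a b / a + b >-> a + b}) ->
  exists (M : lmodType R) (f : {additive V -> M}),
    bijective f /\ forall a v, f (scale a v) = a *: f v.
Proof.
(* The class of V must be exposed to unify with the one of the carrier. *)
case: V scale => T cls scale scaleA scale1 scaleDr scaleDl.
pose V := GRing.Zmodule.Pack cls.
pose m := GRing.Zmodule_isLmodule.Build R (GRing.Zmodule.sort V)
  scaleA scale1 scaleDr scaleDl.
pose M : lmodType R := HB.pack (GRing.Zmodule.sort V) m.
have fB : zmod_morphism (fun x : V => x : M) by [].
pose f : {additive V -> M} := HB.pack (fun x : V => x : M)
  (GRing.isZmodMorphism.Build V M (fun x : V => x : M) fB).
by exists M, f; split=> //; exists id.
Qed.

(** The multiplication is given on representatives: for a quotient of a ring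
    this is its product, for a tensor product the product of two lists of
    pairs. *)
Lemma ex_ring_structure (T : Type) (V : zmodType) (p : T -> V)
    (one : T) (mul : T -> T -> T) :
    surjective p ->
    (forall x x' y y', p x = p x' -> p y = p y' ->
       p (mul x y) = p (mul x' y')) ->
    (forall x y z, p (mul x (mul y z)) = p (mul (mul x y) z)) ->
    (forall x y, p (mul x y) = p (mul y x)) ->
    (forall x, p (mul one x) = p x) ->
    (forall x y z w, p w = p x + p y ->
       p (mul w z) = p (mul x z) + p (mul y z)) ->
  exists (R : comPzRingType) (f : {additive V -> R}),
    [/\ bijective f, f (p one) = 1
      & forall x y, f (p (mul x y)) = f (p x) * f (p y)].
Proof.
move=> surj_p mulE mulA mulC mul1 mulDl.
have [s sK] := surjective_section surj_p.
pose qmul (x y : V) := p (mul (s x) (s y)).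
have qmulE x y : qmul (p x) (p y) = p (mul x y).
  by apply: mulE; rewrite sK.
have qmulA : associative qmul.
  by move=> x y z; rewrite -(sK x) -(sK y) -(sK z) !qmulE.
have qmulC : commutative qmul.
  by move=> x y; rewrite -(sK x) -(sK y) !qmulE.
have qmul1 : left_id (p one) qmul.
  by move=> x; rewrite -(sK x) !qmulE.
have qmulD : left_distributive qmul +%R.
  move=> x y z; rewrite /qmul; apply: mulDl; rewrite !sK //.
have [R [f [fbij f1 fM]]] := ex_comPzRing_on qmulA qmulC qmul1 qmulD.
by exists R, f; split=> // x y; rewrite -fM qmulE.
Qed.

Lemma ex_subgroup_quotient (V : zmodType) (S : V -> Prop) :
    S 0 -> (forall x y, S x -> S y -> S (x - y)) ->
  exists (Q : zmodType) (p : {additive V -> Q}),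
    surjective p /\ forall x, p x = 0 <-> S x.
Proof.
move=> S0 SB.
have SN x : S x -> S (- x) by rewrite -sub0r; exact: SB.
have SD x y : S x -> S y -> S (x + y).
  by move=> Sx /SN Sy; rewrite -[y]opprK; exact: SB.
have [|||||||||Q [f [surj_f fE f0 fD fN]]] := @ex_zmod_quotient V
  (fun x y => S (x - y)) 0 -%R +%R.
- by move=> x; rewrite subrr.
- by move=> x y /SN; rewrite opprB.
- by move=> x y z Sxy Syz; rewrite -(subrKA y); exact: SD.
- by move=> x x' /SN; rewrite opprB opprK addrC.
- by move=> x x' y y' Sx Sy; rewrite opprD addrACA; exact: SD.
- by move=> x y z; rewrite (addrA x) subrr.
- by move=> x y; rewrite (addrC x) subrr.
- by move=> x; rewrite add0r subrr.
- by move=> x; rewrite addNr subrr.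
have fB : zmod_morphism f by move=> x y; rewrite fD fN.
pose p : {additive V -> Q} := HB.pack f (GRing.isZmodMorphism.Build V Q f fB).
exists Q, p; split=> // x; rewrite /= -f0.
by rewrite fE subr0.
Qed.

Lemma ex_ring_quotient (R : comPzRingType) (I : R -> Prop) : is_ideal I ->
  exists (Q : comPzRingType) (p : {rmorphism R -> Q}),
    surjective p /\ forall x, p x = 0 <-> I x.
Proof.
case=> I0 ID IM.
have IB x y : I x -> I y -> I (x - y).
  by move=> Ix /(IM (-1)); rewrite mulN1r; exact: ID.
have [V [p [surj_p ker_p]]] := ex_subgroup_quotient I0 IB.
have pE x y : p x = p y <-> I (x - y).
  rewrite -ker_p raddfB; split=> [->|/eqP]; first exact: subrr.
  by rewrite subr_eq0 => /eqP.
have [|||||Q [f [fbij f1 fM]]] :=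
    @ex_ring_structure R V p 1 *%R surj_p.
- move=> x x' y y' /pE Ix /pE Iy; apply/pE.
  rewrite -(subrKA (x' * y)) -mulrBl -mulrBr.
  by apply: ID; [rewrite mulrC|]; exact: IM.
- by move=> x y z; rewrite mulrA.
- by move=> x y; rewrite mulrC.
- by move=> x; rewrite mul1r.
- move=> x y z w; rewrite -!raddfD => /pE Iw; apply/pE.
  by rewrite -mulrDl -mulrBl mulrC; exact: IM.
pose g x := f (p x).
have gB : zmod_morphism g by move=> x y; rewrite /g !raddfB.
have gM : monoid_morphism g by split=> [|x y]; [exact: f1 | exact: fM].
pose gp : {rmorphism R -> Q} := HB.pack g
  (GRing.isZmodMorphism.Build R Q g gB) (GRing.isMonoidMorphism.Build R Q g gM).
exists Q, gp; split.
  move=> q; have [v <-] : exists v, f v = q.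
    by case: fbij => h _ fK; exists (h q).
  by have [x <-] := surj_p v; exists x.
move=> x; rewrite -ker_p /= /g; split=> [fp0|->]; last exact: raddf0.
by apply: (bij_inj fbij); rewrite fp0 raddf0.
Qed.

Lemma ex_rmorphism (R S : comPzRingType) (f : R -> S) :
    f 1 = 1 -> (forall x y, f (x + y) = f x + f y) ->
    (forall x y, f (x * y) = f x * f y) ->
  exists g : {rmorphism R -> S}, g =1 f.
Proof.
move=> f1 fD fM.
have f0 : f 0 = 0 by apply: (@addrI _ (f 0)); rewrite -fD !addr0.
have fB : zmod_morphism f.
  by move=> x y; apply/eqP; rewrite eq_sym subr_eq -fD subrK.
have fm : monoid_morphism f by [].
pose g : {rmorphism R -> S} := HB.pack f
  (GRing.isZmodMorphism.Build R S f fB) (GRing.isMonoidMorphism.Build R S f fm).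
by exists g.
Qed.

Lemma quotient_factor (R Q C : comPzRingType) (p : {rmorphism R -> Q})
    (f : {rmorphism R -> C}) :
    surjective p -> (forall x, p x = 0 -> f x = 0) ->
  exists g : {rmorphism Q -> C}, forall x, g (p x) = f x.
Proof.
move=> surj_p kerp.
have [s sK] := surjective_section surj_p.
have fE x y : p x = p y -> f x = f y.
  move=> pxy; apply/eqP; rewrite -subr_eq0 -rmorphB; apply/eqP/kerp.
  by rewrite rmorphB pxy subrr.
have [|||g gE] := @ex_rmorphism Q C (f \o s).
- by rewrite /= (fE _ 1) ?sK ?rmorph1.
- by move=> x y; rewrite /= -rmorphD; apply: fE; rewrite rmorphD !sK.
- by move=> x y; rewrite /= -rmorphM; apply: fE; rewrite rmorphM !sK.
- by exists g => x; rewrite gE; apply: fE; rewrite sK.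
Qed.

(** * Tensor products and flatness *)

(** The target is a mere abelian group, so that no module structure has to be
    built where the bilinear maps used below take their values. *)
Definition balanced (A B : comPzRingType) (phi : {rmorphism A -> B})
    (M : lmodType A) (P : zmodType) (beta : M -> B -> P) : Prop :=
  [/\ forall m m' b, beta (m + m') b = beta m b + beta m' b,
      forall m b b', beta m (b + b') = beta m b + beta m b'
    & forall a m b, beta (a *: m) b = beta m (phi a * b)].

Definition tensor_sum (M B : Type) (P : zmodType) (beta : M -> B -> P)
    (l : seq (M * B)) : P :=
  \sum_(x <- l) beta x.1 x.2.

(** A list of pairs stands for a sum of pure tensors; this says that the sum
    vanishes in the tensor product, without mentioning one. *)
Definition tensor_null (A B : comPzRingType) (phi : {rmorphism A -> B})
    (M : lmodType A) (l : seq (M * B)) : Prop :=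
  forall (P : zmodType) (beta : M -> B -> P),
    balanced phi beta -> tensor_sum beta l = 0.

Definition generating (M B : Type) (T : zmodType) (t : M -> B -> T) : Prop :=
  forall x, exists l, x = tensor_sum t l.

Lemma additive0 (U V : zmodType) (f : U -> V) :
  {morph f : x y / x + y} -> f 0 = 0.
Proof. by move=> fD; apply: (@addrI _ (f 0)); rewrite -fD !addr0. Qed.

Lemma additiveN (U V : zmodType) (f : U -> V) :
  {morph f : x y / x + y} -> {morph f : x / - x}.
Proof.
move=> fD x; apply: (@addrI _ (f x)).
by rewrite -fD !subrr (additive0 fD).
Qed.

Lemma tensor_sum_cat (M B : Type) (P : zmodType) (beta : M -> B -> P)
    (l l' : seq (M * B)) :
  tensor_sum beta (l ++ l') = tensor_sum beta l + tensor_sum beta l'.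
Proof. exact: big_cat. Qed.

Section Tensor.
Variables (A B : comPzRingType) (phi : {rmorphism A -> B}) (M : lmodType A).
Implicit Types l : seq (M * B).

Lemma tensor_sum_opp (P : zmodType) (beta : M -> B -> P) l :
    balanced phi beta ->
  tensor_sum beta [seq (- x.1, x.2) | x <- l] = - tensor_sum beta l.
Proof.
case=> Dl _ _; rewrite /tensor_sum big_map -sumrN; apply: eq_bigr => x _.
exact: (additiveN (fun m m' => Dl m m' x.2)).
Qed.

Lemma eq_tensor_sum (T P : zmodType) (t : M -> B -> T) (beta : M -> B -> P)
    l l' :
    balanced phi t -> (forall l, tensor_sum t l = 0 -> tensor_null phi l) ->
    balanced phi beta -> tensor_sum t l = tensor_sum t l' ->
  tensor_sum beta l = tensor_sum beta l'.
Proof.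
move=> bt nullt b /eqP; rewrite -subr_eq0 -(tensor_sum_opp l' bt).
rewrite -tensor_sum_cat => /eqP/nullt/(_ P beta b)/eqP.
by rewrite tensor_sum_cat tensor_sum_opp // subr_eq0 => /eqP.
Qed.

Lemma balanced_bilinear_balanced (T : lmodType A) (t : M -> B -> T) :
  balanced_bilinear phi t -> balanced phi t.
Proof. by case=> Dl Dr Zl Zr; split=> // a m b; rewrite Zl Zr. Qed.

Lemma balanced_scale (P : zmodType) (beta : M -> B -> P) a :
  balanced phi beta -> balanced phi (fun m b => beta (a *: m) b).
Proof.
case=> Dl Dr Zm; split=> [m m' b|m b b'|c m b].
- by rewrite scalerDr Dl.
- by rewrite Dr.
- by rewrite scalerA mulrC -scalerA Zm.
Qed.

(** The tensor product consists of the lists of pairs, two lists being equal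
    when no balanced map distinguishes them; there is then no need of an
    explicit description of the relations. *)
Lemma ex_tensor : exists (T : lmodType A) (t : M -> B -> T),
  [/\ balanced_bilinear phi t, generating t
    & forall l, tensor_sum t l = 0 -> tensor_null phi l].
Proof.
pose e l l' := forall (P : zmodType) (beta : M -> B -> P),
  balanced phi beta -> tensor_sum beta l = tensor_sum beta l'.
have [|||||||||V [p [surj_p pE p0 pD pN]]] := @ex_zmod_quotient
  (seq (M * B)) e [::] (map (fun x => (- x.1, x.2))) cat.
- by [].
- by move=> l l' ll' P beta /ll'.
- by move=> l l' l'' ll' ll'' P beta b; rewrite ll' ?ll''.
- by move=> l l' ll' P beta b; rewrite !tensor_sum_opp // ll'.
- by move=> l1 l1' l2 l2' e1 e2 P beta b; rewrite !tensor_sum_cat e1 ?e2.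
- by move=> l1 l2 l3 P beta _; rewrite catA.
- by move=> l1 l2 P beta _; rewrite !tensor_sum_cat addrC.
- by [].
- by move=> l P beta b; rewrite tensor_sum_cat tensor_sum_opp // addNr
    /tensor_sum big_nil.
have [s sK] := surjective_section surj_p.
pose act (a : A) l := [seq (a *: x.1, x.2) | x <- l].
have actE a l l' : p l = p l' -> p (act a l) = p (act a l').
  move=> /pE ll'; apply/pE => P beta b; rewrite /tensor_sum !big_map.
  exact: ll' (balanced_scale a b).
pose scale a v := p (act a (s v)).
have scaleE a l : scale a (p l) = p (act a l) by apply: actE; rewrite sK.
have [||||T [f [fbij fZ]]] := @ex_lmod_on A V scale.
- move=> a b v; rewrite -(sK v) !scaleE; congr p.
  by rewrite /act -map_comp; apply: eq_map => x /=; rewrite scalerA.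
- move=> v; rewrite -(sK v) !scaleE; congr p.
  by rewrite /act -[RHS]map_id; apply: eq_map => -[x y] /=; rewrite scale1r.
- move=> a v w; rewrite -(sK v) -(sK w) -pD !scaleE -pD; congr p.
  exact: map_cat.
- move=> v a b; rewrite -(sK v) !scaleE -pD; apply/pE => P beta [Dl _ _].
  rewrite tensor_sum_cat /tensor_sum !big_map -big_split /=.
  by apply: eq_bigr => x _; rewrite scalerDl Dl.
pose t m b := f (p [:: (m, b)]).
have tE l : tensor_sum t l = f (p l).
  elim: l => [|[m b] l IH]; first by rewrite /tensor_sum big_nil p0 raddf0.
  rewrite -cat1s tensor_sum_cat IH pD raddfD; congr (_ + _).
  by rewrite /tensor_sum big_seq1.
exists T, t; split.
- split=> [m m' b|m b b'|a m b|a m b]; rewrite /t -?fZ -?raddfD -?pD.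
  + congr (f _); apply/pE => P beta [Dl _ _].
    by rewrite /tensor_sum /= !big_cons !big_nil !addr0 Dl.
  + congr (f _); apply/pE => P beta [_ Dr _].
    by rewrite /tensor_sum /= !big_cons !big_nil !addr0 Dr.
  + by rewrite scaleE.
  + rewrite scaleE; congr (f _); apply/pE => P beta [_ _ Zm].
    by rewrite /tensor_sum !big_seq1 Zm.
- move=> x; case: fbij => g _ gK; exists (s (g x)).
  by rewrite tE sK gK.
- move=> l; rewrite tE -[0](raddf0 f) => /(bij_inj fbij).
  rewrite -p0 => /pE e0 P beta b; rewrite e0 //; exact: big_nil.
Qed.

Lemma ex_linear (T : lmodType A) (P : lmodType A) (t : M -> B -> T)
    (beta : M -> B -> P) :
    balanced_bilinear phi t -> generating t ->
    (forall l, tensor_sum t l = 0 -> tensor_null phi l) ->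
    balanced_bilinear phi beta ->
  exists g : {linear T -> P},
    forall l, g (tensor_sum t l) = tensor_sum beta l.
Proof.
move=> bt gent nullt bb; have b := balanced_bilinear_balanced bb.
have [s sK] := choice gent.
have uE l l' : tensor_sum t l = tensor_sum t l' ->
    tensor_sum beta l = tensor_sum beta l'.
  exact: eq_tensor_sum (balanced_bilinear_balanced bt) nullt b.
pose f x := tensor_sum beta (s x).
have fE l : f (tensor_sum t l) = tensor_sum beta l.
  by apply: uE; rewrite -sK.
have fL : linear f.
  move=> a x y; rewrite [x]sK [y]sK -[LHS](_ : f (tensor_sum t
      ([seq (a *: z.1, z.2) | z <- s x] ++ s y)) = _).
    rewrite !fE tensor_sum_cat; congr (_ + _).
    rewrite /tensor_sum big_map scaler_sumr; apply: eq_bigr => z _.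
    by case: bb => _ _ -> _.
  congr f; rewrite tensor_sum_cat; congr (_ + _).
  rewrite /tensor_sum big_map scaler_sumr; apply: eq_bigr => z _.
  by case: bt => _ _ -> _.
pose g : {linear T -> P} := HB.pack f (GRing.isLinear.Build A T P *:%R f fL).
by exists g.
Qed.

Lemma tensor_product_intro (T : lmodType A) (t : M -> B -> T) :
    balanced_bilinear phi t -> generating t ->
    (forall l, tensor_sum t l = 0 -> tensor_null phi l) ->
  is_tensor_product phi t.
Proof.
move=> bt gent nullt; split=> // P beta bb; split.
  have [g gE] := ex_linear bt gent nullt bb; exists g => m b.
  by have := gE [:: (m, b)]; rewrite /tensor_sum !big_seq1.
move=> g g' gE g'E x; have [l ->] := gent x.
by rewrite /tensor_sum !raddf_sum; apply: eq_bigr => y _ /=; rewrite gE g'E.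
Qed.

(** The comparison maps with the tensor product of [ex_tensor] transport its
    two properties to any other tensor product. *)
Lemma tensor_product_elim (T : lmodType A) (t : M -> B -> T) :
    is_tensor_product phi t ->
  generating t /\ forall l, tensor_sum t l = 0 -> tensor_null phi l.
Proof.
case=> bt univ; have [T' [t' [bt' gent' null']]] := ex_tensor.
have [[g gE] _] := univ T' t' bt'.
have [h hE] := ex_linear bt' gent' null' bt.
have gsum l : g (tensor_sum t l) = tensor_sum t' l.
  by rewrite /tensor_sum raddf_sum; apply: eq_bigr => x _ /=; rewrite gE.
split=> [x|l l0]; last by apply: null'; rewrite -gsum l0 raddf0.
have [l gx] := gent' (g x); exists l; rewrite -hE -gx.
have [_ uniq] := univ T t bt.
have hL : linear (h \o g) by move=> a u v; rewrite /= !linearP.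
pose hg : {linear T -> T} :=
  HB.pack (h \o g) (GRing.isLinear.Build A T T *:%R (h \o g) hL).
have idL : linear (@id T) by [].
pose idl : {linear T -> T} :=
  HB.pack (@id T) (GRing.isLinear.Build A T T *:%R id idL).
apply: (uniq idl hg _ _ x) => // m b /=.
by rewrite gE; have := hE [:: (m, b)];
  rewrite /tensor_sum !big_seq1.
Qed.

End Tensor.

(** The elementwise form of flatness: tensor products are eliminated, and with
    them the need to choose or to compare them. *)
Lemma flatP (A B : comPzRingType) (phi : {rmorphism A -> B}) :
  flat phi <->
  forall (M N : lmodType A) (u : {linear M -> N}), injective u ->
  forall l, tensor_null phi [seq (u x.1, x.2) | x <- l] -> tensor_null phi l.
Proof.
split=> [flat_phi M N u inj_u l null_ul | H M N u inj_u TM TN tM tN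
  isM isN uB uBE].
- have [TM [tM [btM genM nullM]]] := @ex_tensor A B phi M.
  have [TN [tN [btN genN nullN]]] := @ex_tensor A B phi N.
  have isM := tensor_product_intro btM genM nullM.
  have isN := tensor_product_intro btN genN nullN.
  have bb : balanced_bilinear phi (fun m => tN (u m)).
    by case: btN => Dl Dr Zl Zr; split=> *; rewrite ?linearD ?linearZ /=
      ?Dl ?Dr ?Zl ?Zr.
  have [uB uBE] := ex_linear btM genM nullM bb.
  have uBE' m b : uB (tM m b) = tN (u m) b.
    by have := uBE [:: (m, b)]; rewrite /tensor_sum !big_seq1.
  have inj_uB := flat_phi M N u inj_u TM TN tM tN isM isN uB uBE'.
  apply: nullM; apply: inj_uB; rewrite raddf0 uBE.
  have := null_ul TN tN (balanced_bilinear_balanced btN).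
  by rewrite /tensor_sum big_map.
- have [genM nullM] := tensor_product_elim isM.
  have [genN nullN] := tensor_product_elim isN.
  have inj0 x : uB x = 0 -> x = 0.
    have [l ->] := genM x; move=> uB0.
    apply: (H M N u inj_u l) (balanced_bilinear_balanced isM.1).
    apply: nullN; rewrite -uB0 /tensor_sum big_map raddf_sum.
    by apply: eq_bigr => y _ /=; rewrite uBE.
  move=> x y xy; apply/eqP; rewrite -subr_eq0; apply/eqP/inj0.
  by rewrite raddfB /= xy subrr.
Qed.

(** * The tensor product of two algebras *)

(** An alias that carries the structure of A-module obtained by restriction of
    scalars along psi. *)
Definition restr (A K : comPzRingType) (psi : {rmorphism A -> K})
  (M : lmodType K) : Type := M.

Section Restriction.
Variables (A K : comPzRingType) (psi : {rmorphism A -> K}) (M : lmodType K).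

Definition restr_scale (a : A) (m : restr psi M) : restr psi M :=
  psi a *: (m : M).

HB.instance Definition _ := GRing.Zmodule.on (restr psi M).

Lemma restr_scaleA a b m :
  restr_scale a (restr_scale b m) = restr_scale (a * b) m.
Proof. by rewrite /restr_scale scalerA rmorphM. Qed.

Lemma restr_scale1 : left_id 1 restr_scale.
Proof. by move=> m; rewrite /restr_scale rmorph1 scale1r. Qed.

Lemma restr_scaleDr : right_distributive restr_scale +%R.
Proof. by move=> a m m'; rewrite /restr_scale scalerDr. Qed.

Lemma restr_scaleDl m : {morph restr_scale^~ m : a b / a + b >-> a + b}.
Proof. by move=> a b; rewrite /restr_scale rmorphD scalerDl. Qed.

HB.instance Definition _ := GRing.Zmodule_isLmodule.Build A (restr psi M)
  restr_scaleA restr_scale1 restr_scaleDr restr_scaleDl.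

End Restriction.

Section TensorRing.
Variables (A K B : comPzRingType).
Variables (psi : {rmorphism A -> K}) (phi : {rmorphism A -> B}).

(** The third condition says that T has no more relations than the module
    tensor product; the first two alone hold in every quotient of it. *)
Definition is_tensor_ring (T : comPzRingType)
    (i : {rmorphism K -> T}) (j : {rmorphism B -> T}) : Prop :=
  [/\ forall a, i (psi a) = j (phi a),
      generating (fun k b => i k * j b)
    & forall l, tensor_sum (fun k b => i k * j b) l = 0 ->
        tensor_null phi (M := restr psi K^o) l].

(** The product of two lists is the list of all products of their entries. It
    respects the congruence of [ex_tensor] because, for a balanced beta and a
    fixed list, the sum of the values of beta on the products is balanced in
    the remaining pair. *)
Lemma ex_tensor_ring : exists (T : comPzRingType)
    (i : {rmorphism K -> T}) (j : {rmorphism B -> T}), is_tensor_ring i j.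
Proof.
have [V [t [bt gent nullt]]] := @ex_tensor A B phi (restr psi K^o).
have [Dl Dr Zm] := balanced_bilinear_balanced bt.
pose p (l : seq (K * B)) : V := tensor_sum t l.
have surj_p : surjective p by move=> x; have [l ->] := gent x; exists l.
have pE l l' (P : zmodType) (beta : K -> B -> P) : p l = p l' ->
    balanced phi (M := restr psi K^o) beta ->
    tensor_sum beta l = tensor_sum beta l'.
  by move=> e b; apply: (eq_tensor_sum (And3 Dl Dr Zm) nullt b e).
pose mul (l l' : seq (K * B)) :=
  [seq (x.1 * y.1, x.2 * y.2) | x <- l, y <- l'].
have mulE (P : zmodType) (beta : K -> B -> P) l l' :
    tensor_sum beta (mul l l') =
    \sum_(x <- l) \sum_(y <- l') beta (x.1 * y.1) (x.2 * y.2).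
  by rewrite /tensor_sum /mul big_allpairs_dep.
have mulC l l' : p (mul l l') = p (mul l' l).
  rewrite /p !mulE exchange_big; apply: eq_bigr => x _.
  by apply: eq_bigr => y _; rewrite mulrC [x.2 * _]mulrC.
have mulEl l1 l2 l : p l1 = p l2 -> p (mul l1 l) = p (mul l2 l).
  move=> e12; rewrite /p !mulE.
  apply: (pE l1 l2 _ (fun k b => \sum_(y <- l) t (k * y.1) (b * y.2)) e12).
  split=> [k k' b|k b b'|a k b]; rewrite -?big_split /=;
    apply: eq_bigr => y _.
  - by rewrite mulrDl Dl.
  - by rewrite mulrDl Dr.
  - have := Zm a (k * y.1) (b * y.2).
    by rewrite /GRing.scale /= /restr_scale /= -[X in X -> _]/(_ = _)
      [psi a *: _]mulrA mulrA.
have [|||||T [f [fbij f1 fM]]] :=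
    @ex_ring_structure (seq (K * B)) V p [:: (1, 1)] mul surj_p.
- move=> l1 l2 l1' l2' e1 e2.
  by rewrite (mulEl _ _ l1' e1) mulC (mulEl _ _ l2 e2) mulC.
- move=> l1 l2 l3; rewrite /p !mulE /mul big_allpairs_dep /=.
  apply: eq_bigr => x _; rewrite big_allpairs_dep; apply: eq_bigr => y _.
  by apply: eq_bigr => z _; rewrite /= !mulrA.
- exact: mulC.
- move=> l; rewrite /p mulE big_seq1; apply: eq_bigr => x _.
  by rewrite !mul1r.
- move=> l1 l2 l3 l; rewrite /p -tensor_sum_cat => /mulEl.
  by rewrite /p => ->; rewrite !mulE big_cat.
pose i0 k := f (p [:: (k, 1)]); pose j0 b := f (p [:: (1, b)]).
have ijM k b : i0 k * j0 b = f (p [:: (k, b)]).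
  by rewrite -fM /mul /= mulr1 mul1r.
have pseq1 k b : p [:: (k, b)] = t k b by rewrite /p /tensor_sum big_seq1.
have [||| i iE] := @ex_rmorphism K T i0.
- by [].
- by move=> x y; rewrite /i0 -raddfD !pseq1 Dl.
- by move=> x y; rewrite /i0 -fM /mul /= mulr1.
have [||| j jE] := @ex_rmorphism B T j0.
- by [].
- by move=> x y; rewrite /j0 -raddfD !pseq1 Dr.
- by move=> x y; rewrite /j0 -fM /mul /= mulr1.
have sumE l : tensor_sum (fun k b => i k * j b) l = f (p l).
  rewrite /p /tensor_sum raddf_sum; apply: eq_bigr => x _ /=.
  by rewrite iE jE ijM pseq1.
exists T, i, j; split.
- move=> a; rewrite iE jE /i0 /j0 !pseq1; congr (f _).
  have := Zm a 1 1; rewrite mulr1 /GRing.scale /= /restr_scale => <-.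
  by congr (t _ _); rewrite [RHS]mulr1.
- move=> x; have [v <-] : exists v, f v = x.
    by case: fbij => h _ fK; exists (h x).
  by have [l ->] := gent v; exists l; rewrite sumE.
- move=> l; rewrite sumE -[0](raddf0 f) => /(bij_inj fbij); exact: nullt.
Qed.

Variables (T : comPzRingType) (i : {rmorphism K -> T}) (j : {rmorphism B -> T}).
Hypothesis tensT : is_tensor_ring i j.

Lemma tensor_ring_balanced :
  balanced phi (M := restr psi K^o) (fun k b => i k * j b).
Proof.
have [ij _ _] := tensT; split=> [k k' b|k b b'|a k b].
- by rewrite rmorphD mulrDl.
- by rewrite rmorphD mulrDr.
- by rewrite [i _]rmorphM ij rmorphM mulrA [i k * _]mulrC.
Qed.

Lemma tensor_ring_additive (P : zmodType) (beta : K -> B -> P) :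
    balanced phi (M := restr psi K^o) beta ->
  exists f : {additive T -> P}, forall k b, f (i k * j b) = beta k b.
Proof.
move=> b; have [ij genT nullT] := tensT.
have [s sK] := choice genT.
have uE l l' : tensor_sum (fun k b => i k * j b) l =
    tensor_sum (fun k b => i k * j b) l' ->
    tensor_sum beta l = tensor_sum beta l'.
  exact: (eq_tensor_sum tensor_ring_balanced nullT b).
pose f x := tensor_sum beta (s x).
have fE l : f (tensor_sum (fun k b => i k * j b) l) = tensor_sum beta l.
  by apply: uE; rewrite -sK.
have fD : {morph f : x y / x + y}.
  by move=> x y; rewrite [in LHS](sK x) [in LHS](sK y) -tensor_sum_cat fE
    tensor_sum_cat.
have fB : zmod_morphism f by move=> x y; rewrite fD (additiveN fD).
pose g : {additive T -> P} := HB.pack f (GRing.isZmodMorphism.Build T P f fB).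
exists g => k x; have := fE [:: (k, x)].
by rewrite /tensor_sum !big_seq1.
Qed.

Lemma tensor_ring_ind (S : T -> Prop) :
    S 0 -> (forall x y, S x -> S y -> S (x + y)) ->
    (forall k b, S (i k * j b)) ->
  forall x, S x.
Proof.
move=> S0 SD Sij x; have [_ genT _] := tensT; have [l ->] := genT x.
by rewrite /tensor_sum; elim/big_ind: _.
Qed.

Lemma tensor_ring_pushout (C : comPzRingType)
    (v : {rmorphism K -> C}) (w : {rmorphism B -> C}) :
    (forall a, v (psi a) = w (phi a)) ->
  exists g : {rmorphism T -> C},
    (forall k, g (i k) = v k) /\ (forall b, g (j b) = w b).
Proof.
move=> vw.
have [|f fE] := @tensor_ring_additive C (fun k b => v k * w b).
  split=> [k k' b|k b b'|a k b]; rewrite ?rmorphD ?mulrDl ?mulrDr //.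
  by rewrite [v _]rmorphM vw rmorphM mulrA [v k * _]mulrC.
have [|||g gE] := @ex_rmorphism T C f.
- by have := fE 1 1; rewrite !rmorph1 !mulr1.
- exact: raddfD.
- move=> x y; move: x; apply: tensor_ring_ind.
  + by rewrite mul0r raddf0 mul0r.
  + by move=> x x' e e'; rewrite mulrDl !raddfD e e' mulrDl.
  move=> k b; move: y; apply: tensor_ring_ind.
  + by rewrite mulr0 raddf0 mulr0.
  + by move=> y y' e e'; rewrite mulrDr !raddfD e e' mulrDr.
  by move=> k' b'; rewrite mulrACA -!rmorphM !fE !rmorphM mulrACA.
- exists g; split=> [k|b]; rewrite gE.
  + by rewrite -[i k]mulr1 -(rmorph1 j) fE rmorph1 mulr1.
  + by rewrite -[j b]mul1r -(rmorph1 i) fE rmorph1 mul1r.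
Qed.

Lemma tensor_ring_ext (C : comPzRingType) (g h : {rmorphism T -> C}) :
    (forall k, g (i k) = h (i k)) -> (forall b, g (j b) = h (j b)) ->
  g =1 h.
Proof.
move=> gi gj; apply: tensor_ring_ind => [|x y e e'|k b].
- by rewrite !rmorph0.
- by rewrite !rmorphD e e'.
- by rewrite !rmorphM gi gj.
Qed.

End TensorRing.

(** * Base change of etale maps *)

Lemma span_is_ideal (R : comPzRingType) (n : nat) (f : 'I_n -> R) :
  is_ideal (fun y => exists c : 'I_n -> R, y = \sum_(j < n) c j * f j).
Proof.
split=> [|x y [c ->] [d ->]|a x [c ->]].
- by exists (fun=> 0); rewrite big1 // => j _; rewrite mul0r.
- exists (fun j => c j + d j); rewrite -big_split.
  by apply: eq_bigr => j _; rewrite mulrDl.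
- exists (fun j => a * c j); rewrite mulr_sumr.
  by apply: eq_bigr => j _; rewrite mulrA.
Qed.

Section BaseChange.
Variables (A K B T : comPzRingType).
Variables (psi : {rmorphism A -> K}) (phi : {rmorphism A -> B}).
Variables (i : {rmorphism K -> T}) (j : {rmorphism B -> T}).
Hypothesis tensT : is_tensor_ring psi phi i j.

(** Half of the isomorphism between M (x)_K (K (x)_A B) and M (x)_A B: a map
    balanced over A on M and B determines one on M and K (x)_A B. *)
Lemma tensor_ring_extend (M : lmodType K) (P : zmodType)
    (beta : M -> B -> P) :
    balanced phi (M := restr psi M) beta ->
  exists beta' : M -> T -> P, balanced i beta' /\
    forall m b, beta' m (j b) = beta m b.
Proof.
case=> Dl Dr Zm.
have ex m : exists f : {additive T -> P},
    forall k b, f (i k * j b) = beta (k *: m) b.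
  apply: (tensor_ring_additive tensT).
  split=> [k k' b|k b b'|a k b].
  - by rewrite scalerDl Dl.
  - by rewrite Dr.
  - by rewrite -Zm /GRing.scale /= /restr_scale scalerA.
have [f fE] := choice ex; exists (fun m => f m); split.
  split=> [m m' x|m x x'|k m x].
  - elim/(tensor_ring_ind tensT): x => [|x y e e'|k b].
    + by rewrite !raddf0 addr0.
    + by rewrite !raddfD e e' addrACA.
    + by rewrite !fE scalerDr Dl.
  - exact: raddfD.
  - elim/(tensor_ring_ind tensT): x => [|x y e e'|k' b].
    + by rewrite mulr0 !raddf0.
    + by rewrite mulrDr !raddfD e e'.
    + by rewrite mulrA -rmorphM !fE scalerA mulrC.
by move=> m b; have := fE m 1 b; rewrite rmorph1 mul1r scale1r.
Qed.

(** For a K-module M the group M (x)_K (K (x)_A B) is M (x)_A B. On lists of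
    pairs this isomorphism is [expand], which rewrites every entry (m, x) as
    the pairs (k m, b) for an expression of x as a sum of k (x) b. *)
Lemma flat_base_change : flat phi -> flat i.
Proof.
move=> /flatP flat_phi; apply/flatP => M N u inj_u l null_ul.
have [_ genT _] := tensT; have [s sK] := choice genT.
pose expand (M' : lmodType K) (l' : seq (M' * T)) : seq (M' * B) :=
  [seq (y.1 *: x.1, y.2) | x <- l', y <- s x.2].
have sumE (M' : lmodType K) (P : zmodType) (beta : M' -> T -> P) l' :
    balanced i beta -> tensor_sum beta l' =
      tensor_sum (fun m b => beta m (j b)) (expand M' l').
  move=> [Dl Dr Zm]; rewrite /tensor_sum big_allpairs_dep.
  apply: eq_bigr => -[m x] _ /=; rewrite {1}(sK x).
  rewrite (big_morph (beta m) (Dr m) (additive0 (Dr m))).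
  by apply: eq_bigr => y _; rewrite Zm.
have uL : linear (u : restr psi M -> restr psi N).
  by move=> a x y; exact: (linearP u (psi a) x y).
pose u' : {linear restr psi M -> restr psi N} :=
  HB.pack (u : restr psi M -> restr psi N)
    (GRing.isLinear.Build A (restr psi M) (restr psi N) *:%R u uL).
suff null_l : tensor_null phi (M := restr psi M) (expand M l).
  move=> P beta b; rewrite sumE //; apply: null_l.
  case: b => Dl Dr Zm; split=> [m m' b|m b b'|a m b].
  - exact: Dl.
  - by rewrite rmorphD Dr.
  - have [ij _ _] := tensT.
    by rewrite /GRing.scale /= /restr_scale Zm ij rmorphM.
apply: (flat_phi _ _ u' inj_u) => P beta b.
have [beta' [b' bE]] := tensor_ring_extend b.
have := null_ul P beta' b'; rewrite sumE // => <-.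
rewrite /tensor_sum /expand !big_map !big_allpairs_dep big_map.
apply: eq_bigr => x _; apply: eq_bigr => y _ /=.
by rewrite bE linearZ.
Qed.

Lemma unramified_base_change :
  formally_unramified phi -> formally_unramified i.
Proof.
move=> unr C D p surj_p sq0 g h ghi pgh.
apply: (tensor_ring_ext tensT) => // b.
apply: (unr C D p surj_p sq0 (g \o j) (h \o j)) => [a|b'] /=.
  by have [ij _ _] := tensT; rewrite -ij ghi.
exact: pgh.
Qed.

(** If B = P/(f) with P a polynomial ring over A, then K (x)_A P is a polynomial
    ring over K and K (x)_A B is its quotient by the same f. That no further
    relation appears is seen by mapping B to the quotient D of K (x)_A P by f,
    which extends to a map from K (x)_A B to D. *)
Lemma finitely_presented_base_change :
  finitely_presented phi -> finitely_presented i.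
Proof.
case=> n [P [iota [X [q [polyP qE surj_q [m [f ker_q]]]]]]].
have [PK [i' [j' tensP]]] := ex_tensor_ring psi iota.
have [ij _ _] := tensT; have [ij' _ _] := tensP.
have [|qK [qKi qKj]] := tensor_ring_pushout tensP (v := i) (w := j \o q).
  by move=> a; rewrite /= qE ij.
exists n, PK, i', (j' \o X), qK; split=> //.
- move=> C v c; have [[g [gi gX]] _] := polyP C (v \o psi) c.
  split; last first.
    move=> h h' ei eX; apply: (tensor_ring_ext tensP) => // y.
    have [_ uniq] := polyP C (v \o psi) c.
    apply: (uniq (h \o j') (h' \o j')) => [a|k] /=; last exact: eX.
    by rewrite -ij' ei.
  have [//|h [hi hj]] := tensor_ring_pushout tensP (v := v) (w := g).
  by exists h; split=> // k; rewrite /= hj gX.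
- move=> x; elim/(tensor_ring_ind tensT): x => [|x y [x' <-] [y' <-]|k b].
  + by exists 0; rewrite rmorph0.
  + by exists (x' + y'); rewrite rmorphD.
  + have [y <-] := surj_q b; exists (i' k * j' y).
    by rewrite rmorphM qKi qKj.
exists m, (j' \o f) => y; split; last first.
  case=> c ->; rewrite rmorph_sum big1 // => k _; rewrite rmorphM /= qKj /=.
  rewrite (_ : q (f k) = 0) ?rmorph0 ?mulr0 //; apply/ker_q.
  exists (fun l => (l == k)%:R).
  rewrite (bigD1 k) //= eqxx mul1r big1 ?addr0 //.
  by move=> l /negPf ->; rewrite mul0r.
have [D [p [surj_p pE]]] := ex_ring_quotient (span_is_ideal (j' \o f)).
have [|w wE] := @quotient_factor P B D q (p \o j') surj_q.
  move=> x /ker_q [c ->]; apply/pE; exists (j' \o c).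
  by rewrite rmorph_sum; apply: eq_bigr => k _; rewrite rmorphM.
have [|g [gi gj]] := tensor_ring_pushout tensT (v := p \o i') (w := w).
  by move=> a; rewrite -qE wE /= ij'.
have gq : g \o qK =1 p.
  by apply: (tensor_ring_ext tensP) => [k|x] /=;
    rewrite ?qKi ?qKj /= ?gi ?gj ?wE.
by move=> qy0; apply/pE; rewrite -gq /= qy0 rmorph0.
Qed.

Lemma etale_base_change : etale phi -> etale i.
Proof.
case=> fl un fp; split; first exact: flat_base_change.
  exact: unramified_base_change.
exact: finitely_presented_base_change.
Qed.

End BaseChange.

(** * Standard etale algebras *)

(** Coefficients of {poly _} form a nonzero ring; the equation between rings
    allows to substitute C' for C wherever C occurs. *)
Lemma comNzRing_of (C : comPzRingType) : (1 : C) <> 0 ->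
  exists C' : comNzRingType, C = C' :> comPzRingType.
Proof.
case: C => T cls; set C := GRing.ComPzRing.Pack cls => n0.
have n0' : (1 : C) != 0 by apply/eqP.
pose m := GRing.PzSemiRing_isNonZero.Build (GRing.ComPzRing.sort C) n0'.
pose C' : comNzRingType := HB.pack (GRing.ComPzRing.sort C) m.
by exists C'.
Qed.

Lemma zero_ring (C : comPzRingType) : (1 : C) = 0 -> forall x y : C, x = y.
Proof. by move=> e x y; rewrite -[x]mulr1 -[y]mulr1 e !mulr0. Qed.

Lemma ex_poly_eval (A : comNzRingType) (C : comPzRingType)
    (v : {rmorphism A -> C}) (x : C) :
  exists e : {rmorphism {poly A} -> C},
    (forall a, e a%:P = v a) /\ e 'X = x.
Proof.
have [e0|n0] := pselect ((1 : C) = 0).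
  have [|||e _] := @ex_rmorphism {poly A} C (fun=> 0);
    try by move=> *; exact: (zero_ring e0).
  by exists e; split=> *; exact: (zero_ring e0).
have [C' eC] := comNzRing_of n0; move: v x n0; rewrite {}eC => v x _.
have cv : commr_rmorph v x by move=> a; exact: mulrC.
exists (horner_morph cv); split=> [a|].
  exact: horner_morphC.
exact: horner_morphX.
Qed.

Lemma poly_rmorph_ext (A : comNzRingType) (C : comPzRingType)
    (e e' : {rmorphism {poly A} -> C}) :
  (forall a, e a%:P = e' a%:P) -> e 'X = e' 'X -> e =1 e'.
Proof.
move=> eC eX; elim/poly_ind => [|p c IH]; first by rewrite !rmorph0.
by rewrite !rmorphD !rmorphM IH eX eC.
Qed.

Section StandardEtale.
Variables (A : comNzRingType) (P g : {poly A}).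
Hypotheses (monP : P \is monic) (dP : exists u, g = P^`() * u).

Notation R := {poly {poly A}}.

(** The outer variable of {poly {poly A}} is the inverse Y of g; the relations
    are P = 0 and g Y = 1. *)
Definition std_relation (i : 'I_2) : R :=
  if i == 0 then P%:P else g%:P * 'X - 1.

Lemma sum_std_relation (c : 'I_2 -> R) :
  \sum_(i < 2) c i * std_relation i =
  c 0 * P%:P + c 1 * (g%:P * 'X - 1).
Proof.
rewrite !big_ord_recl big_ord0 addr0 /std_relation /=.
by rewrite (_ : lift ord0 ord0 = 1) //; exact: val_inj.
Qed.

(** If F = sum_n F_n Y^n then [numer k F] is sum_(n <= k) F_n g^(k - n). For k
    at least the degree of F in Y this is g^k F once Y is 1/g: the numerator of
    F over the denominator g^k. *)
Fixpoint numer (k : nat) (F : R) : {poly A} :=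
  if k is k'.+1 then g * numer k' F + F`_k else F`_0.

Lemma numerS k F : numer k.+1 F = g * numer k F + F`_k.+1.
Proof. by []. Qed.

(** The numerators modulo P, as polynomials of degree less than that of P. The
    ring A[X]/(P)[1/g] is the direct limit of copies of A[X]/(P) along
    multiplication by g, and [rnumer k] reads an element in the k-th copy. *)
Definition rnumer k F := rmodp (numer k F) P.

Lemma numerD k F G : numer k (F + G) = numer k F + numer k G.
Proof.
elim: k => [|k IH] /=; first by rewrite coefD.
by rewrite IH coefD mulrDr addrACA.
Qed.

Lemma numerM k (c : {poly A}) F : numer k (c%:P * F) = c * numer k F.
Proof.
elim: k => [|k IH] /=; first by rewrite coefCM.
by rewrite IH coefCM mulrDr mulrCA.
Qed.

(** The sum telescopes; what remains is 0 as soon as k exceeds the degree in Y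
    of the cofactor F. *)
Lemma numer_relation k F : numer k (F * (g%:P * 'X - 1)) = - F`_k.
Proof.
have E m : (F * (g%:P * 'X - 1))`_m.+1 = F`_m * g - F`_m.+1.
  by rewrite mulrBr mulr1 mulrA coefB coefMX coefMC.
elim: k => [|k IH] /=.
  by rewrite mulrBr mulr1 mulrA coefB coefMX sub0r.
by rewrite IH E mulrN mulrC addKr.
Qed.

Lemma numer1 k : numer k 1 = g ^+ k.
Proof.
elim: k => [|k IH] /=; first by rewrite coef1.
by rewrite IH coef1 addr0 exprS.
Qed.

Lemma rnumerD k F G : rnumer k (F + G) = rnumer k F + rnumer k G.
Proof. by rewrite /rnumer numerD rmodpD. Qed.

Lemma rnumerM k (a : A) F : rnumer k (a%:P%:P * F) = a *: rnumer k F.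
Proof. by rewrite /rnumer numerM mul_polyC rmodpZ. Qed.

Lemma rnumer_span (c : 'I_2 -> R) : exists K, forall k, (K <= k)%N ->
  rnumer k (\sum_(i < 2) c i * std_relation i) = 0.
Proof.
exists (size (c 1)) => k lek.
rewrite sum_std_relation rnumerD /rnumer numer_relation nth_default // oppr0.
by rewrite rmod0p addr0 mulrC numerM mulrC rmodp_mull.
Qed.

Variables (B : comPzRingType) (q : {rmorphism R -> B}).
Hypothesis surj_q : surjective q.
Hypothesis ker_q : forall F, q F = 0 <->
  exists c : 'I_2 -> R, F = \sum_(i < 2) c i * std_relation i.

Let phi : {rmorphism A -> B} := q \o polyC \o polyC.
Let e : {rmorphism {poly A} -> B} := q \o polyC.

Lemma std_root : e P = 0.
Proof.
apply/ker_q; exists (fun i => (i == 0)%:R).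
by rewrite sum_std_relation /= mul1r mul0r addr0.
Qed.

Lemma std_inv : e g * q 'X = 1.
Proof.
apply/eqP; rewrite -[e g]/(q g%:P) -subr_eq0 -rmorphM -(rmorph1 q) -rmorphB.
apply/eqP/ker_q.
exists (fun i => (i == 1)%:R).
by rewrite sum_std_relation /= mul1r mul0r add0r.
Qed.

(** Each element of B is y^k times an A-combination of the powers of x below
    the degree of P, with coefficients read off from [rnumer k]. *)
Lemma std_expand (F : R) k d : (size F <= k.+1)%N -> (size P <= d)%N ->
  q F = \sum_(j < d) phi (rnumer k F)`_j * (e 'X ^+ j * q 'X ^+ k).
Proof.
move=> leF lePd.
have E m : \sum_(n < m.+1) e F`_n * q 'X ^+ n = e (numer m F) * q 'X ^+ m.
  elim: m => [|m IH]; first by rewrite big_ord1.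
  rewrite big_ord_recr [LHS]/= IH numerS rmorphD rmorphM exprS mulrDl.
  by rewrite [e g * _]mulrC -!mulrA [e g * _]mulrA std_inv mul1r.
have -> : q F = e (numer k F) * q 'X ^+ k.
  rewrite -E -[in LHS](coefK F) poly_def rmorph_sum.
  rewrite (big_ord_widen _ (fun n => q (F`_n *: 'X^n)) leF) big_mkcond.
  apply: eq_bigr => n _; case: ltnP => ltn.
    by rewrite -mul_polyC rmorphM rmorphXn.
  by rewrite nth_default // rmorph0 mul0r.
have -> : e (numer k F) = e (rnumer k F).
  by rewrite {1}(rdivp_eq monP (numer k F)) rmorphD rmorphM std_root mulr0
    add0r.
have les : (size (rnumer k F) <= d)%N.
  apply: leq_trans lePd; apply: ltnW; apply: ltn_rmodpN0.
  exact: monic_neq0.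
rewrite -[in LHS](coefK (rnumer k F)) poly_def rmorph_sum mulr_suml.
pose term n := e ((rnumer k F)`_n *: 'X^n) * q 'X ^+ k.
rewrite (big_ord_widen _ term les) {}/term.
rewrite big_mkcond; apply: eq_bigr => n _; case: ltnP => ltn.
  by rewrite -mul_polyC rmorphM rmorphXn mulrA.
by rewrite nth_default // rmorph0 mul0r.
Qed.

(** For an A-module N, the tensor product of N with B embeds in the germs at
    infinity of sequences, indexed by k, of families of elements of N: the
    tensor of n and F is sent to the coefficients of [rnumer k F] times n. If a
    list becomes null over N, these germs vanish, so the coefficients vanish
    for large k already in M because u is injective, and [std_expand] for
    one such k writes the list as null tensors. *)
Lemma std_flat : flat phi.
Proof.
apply/flatP => M N u inj_u l null_ul.
have [s sK] := surjective_section surj_q.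
pose V : zmodType := (nat -> nat -> N).
pose S (v : V) := exists K, forall k, (K <= k)%N -> forall j, v k j = 0.
have S0 : S 0 by exists 0%N.
have SB v w : S v -> S w -> S (v - w).
  move=> [K vK] [K' wK]; exists (maxn K K') => k; rewrite geq_max.
  case/andP=> leK leK' j.
  by rewrite -[LHS]/(v k j - w k j) vK // wK // subr0.
have [Q [p [_ ker_p]]] := ex_subgroup_quotient S0 SB.
pose row (n : N) F : V := fun k j => (rnumer k F)`_j *: n.
have rowDr n F G : row n (F + G) = row n F + row n G.
  by apply/funext => k; apply/funext => j; rewrite /row rnumerD coefD scalerDl.
have row_ker n F G : q F = q G -> p (row n F) = p (row n G).
  move/eqP; rewrite -subr_eq0 -rmorphB => /eqP/ker_q[c FG].
  have -> : F = G + (F - G) by rewrite addrC subrK.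
  rewrite rowDr raddfD FG; apply/eqP; rewrite -subr_eq0 addrC addKr.
  apply/eqP/ker_p; have [K vK] := rnumer_span c; exists K => k leK j.
  by rewrite /row vK // coef0 scale0r.
pose beta (n : N) (b : B) : Q := p (row n (s b)).
have bal : balanced phi beta.
  split=> [n n' b|n b b'|a n b]; rewrite /beta.
  - rewrite -raddfD; congr (p _); apply/funext => k; apply/funext => j.
    exact: scalerDr.
  - by rewrite -raddfD -rowDr; apply: row_ker; rewrite rmorphD !sK.
  - rewrite (_ : row (a *: n) (s b) = row n (a%:P%:P * s b)).
      by apply: row_ker; rewrite rmorphM !sK.
    apply/funext => k; apply/funext => j.
    by rewrite /row rnumerM coefZ scalerA mulrC.
pose w k j := \sum_(x <- l) (rnumer k (s x.2))`_j *: x.1.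
have [K wK] : exists K, forall k, (K <= k)%N -> forall j, w k j = 0.
  have := null_ul Q beta bal.
  rewrite /tensor_sum big_map -raddf_sum => /ker_p [K vK].
  exists K => k leK j; apply: inj_u; rewrite raddf0 -(vK k leK j).
  rewrite /w raddf_sum !fct_sumE; apply: eq_bigr => x _ /=.
  by rewrite linearZ.
move=> P' beta' [Dl Dr Zm].
(* At this index the coefficients w vanish and all entries of l expand. *)
pose k := maxn K (\max_(x <- l) size (s x.2)).
have leK : (K <= k)%N by exact: leq_maxl.
have lek x : x \in l -> (size (s x.2) <= k.+1)%N.
  move=> xl; apply: leqW; apply: leq_trans (leq_maxr _ _).
  by rewrite (big_rem x xl) leq_maxl.
rewrite /tensor_sum.
transitivity (\sum_(x <- l) \sum_(j < size P)
    beta' ((rnumer k (s x.2))`_j *: x.1) (e 'X ^+ j * q 'X ^+ k)).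
  rewrite big_seq [RHS]big_seq; apply: eq_bigr => x xl.
  rewrite -[in LHS](sK x.2) (std_expand (lek x xl) (leqnn _)).
  rewrite (big_morph (beta' x.1) (Dr x.1) (additive0 (Dr x.1))).
  by apply: eq_bigr => j _; rewrite Zm.
rewrite exchange_big big1 // => j _.
have Dj := fun m m' => Dl m m' (e 'X ^+ j * q 'X ^+ k).
rewrite -(big_morph (beta'^~ _) Dj (additive0 Dj)).
by rewrite -[X in beta' X]/(w k j) wK // (additive0 Dj).
Qed.

(** Two lifts x1, x2 of the image of x differ by delta with delta^2 = 0. Taylor
    expansion of P gives 0 = P'(x2) delta, and P' is invertible in B since it
    divides g; the image of y is determined as an inverse. *)
Lemma std_unramified : formally_unramified phi.
Proof.
move=> C D p surj_p sq0 h1 h2 h12 ph12.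
have [u gE] := dP.
pose x := e 'X; pose y := q 'X.
have [delta deltaE] : exists delta, delta = h1 x - h2 x by eexists.
have pdelta : p delta = 0 by rewrite deltaE rmorphB ph12 subrr.
have delta2 : delta * delta = 0 by exact: sq0.
have taylor F : h1 (e F) = h2 (e F) + h2 (e F^`()) * delta.
  elim/poly_ind: F => [|F c IH].
    by rewrite deriv0 !rmorph0 mul0r addr0.
  rewrite derivD derivC addr0 derivM derivX mulr1 !rmorphD !rmorphM /= IH.
  rewrite -/x (_ : h1 x = h2 x + delta); last by rewrite deltaE addrC subrK.
  rewrite (h12 c : h1 (e c%:P) = h2 (e c%:P)) addrAC; congr (_ + _).
  rewrite mulrDl mulrDr -addrA; congr (_ + _).
  rewrite mulrDr -(mulrA _ delta delta) delta2 mulr0 addr0 mulrDl addrC.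
  by congr (_ + _); rewrite mulrAC.
have delta0 : delta = 0.
  have := taylor P; rewrite std_root !rmorph0 add0r => e0.
  have inv : h2 (e P^`()) * (h2 (e u) * h2 y) = 1.
    rewrite mulrA -(rmorphM h2) -(rmorphM e) -gE -(rmorphM h2) std_inv.
    exact: rmorph1.
  by rewrite -[delta]mul1r -inv mulrAC -e0 mul0r.
have he F : h1 (e F) = h2 (e F) by rewrite taylor delta0 mulr0 addr0.
have hy : h1 y = h2 y.
  have inv1 : h1 (e g) * h1 y = 1 by rewrite -rmorphM std_inv rmorph1.
  have inv2 : h2 (e g) * h2 y = 1 by rewrite -rmorphM std_inv rmorph1.
  by rewrite -[h1 y]mul1r -inv2 mulrAC -he inv1 mul1r.
move=> b; have [F <-] := surj_q b.
exact: (poly_rmorph_ext (e := h1 \o q) (e' := h2 \o q)).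
Qed.

Lemma std_finitely_presented : finitely_presented phi.
Proof.
exists 2%N, R, (polyC \o polyC), (fun i => if i == 0 then 'X%:P else 'X), q.
split=> //; last by exists 2%N, std_relation.
move=> C v c; split.
  have [f [fC fX]] := ex_poly_eval v (c 0).
  have [h [hC hX]] := ex_poly_eval f (c 1).
  exists h; split=> [a|i]; first by rewrite /= hC fC.
  case: i => -[|[|//]] lti /=; rewrite ?hX ?hC ?fX; congr c; exact: val_inj.
move=> h h' hC hX; apply: poly_rmorph_ext; last exact: (hX 1).
apply: (poly_rmorph_ext (e := h \o polyC) (e' := h' \o polyC)) => //.
exact: (hX 0).
Qed.

Lemma std_etale : etale phi.
Proof.
split; [exact: std_flat|exact: std_unramified|exact: std_finitely_presented].
Qed.

End StandardEtale.

(** The last clause serves to recognize nonzero algebras: it makes the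
    localization at an element that is not nilpotent nonzero. *)
Lemma ex_std_etale (A : comNzRingType) (P g : {poly A}) :
    P \is monic -> (exists u, g = P^`() * u) ->
  exists (B : comPzRingType) (e : {rmorphism {poly A} -> B}) (y : B),
  [/\ etale (e \o polyC), e P = 0, e g * y = 1,
      forall (C : comPzRingType) (f : {rmorphism {poly A} -> C}) (z : C),
        f P = 0 -> f g * z = 1 ->
        exists h : {rmorphism B -> C}, forall p, h (e p) = f p
    & (1 : B) = 0 -> exists k, rmodp (g ^+ k) P = 0].
Proof.
move=> monP dP.
have [B [q [surj_q ker_q]]] :=
  ex_ring_quotient (span_is_ideal (std_relation P g)).
exists B, (q \o polyC), (q 'X); split.
- exact: (std_etale monP dP surj_q ker_q).
- exact: (std_root ker_q).
- exact: (std_inv ker_q).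
- move=> C f z fP fz; have [h [hC hX]] := ex_poly_eval f z.
  have [|h' hE] := @quotient_factor _ B C q h surj_q.
    move=> F /ker_q[c ->]; rewrite sum_std_relation rmorphD !rmorphM rmorphB.
    by rewrite rmorphM rmorph1 !hC hX fP fz subrr !mulr0 addr0.
  by exists h' => p; rewrite /= hE hC.
- rewrite -(rmorph1 q) => /ker_q [c c1].
  have [K vK] := @rnumer_span _ P g monP c; exists K.
  by rewrite -numer1 c1; exact: (vK K (leqnn K)).
Qed.

(** * Local objects are strictly henselian *)

Definition invertible (R : comPzRingType) (x : R) : Prop :=
  exists y, x * y = 1.

Definition nilpotent (R : comPzRingType) (x : R) : Prop :=
  exists n, x ^+ n = 0.

Lemma invertibleMl (R : comPzRingType) (x y : R) :
  invertible (x * y) -> invertible y.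
Proof. by case=> z e; exists (x * z); rewrite mulrCA mulrA. Qed.

Lemma rmorph_invertible (R S : comPzRingType) (f : {rmorphism R -> S}) x :
  invertible x -> invertible (f x).
Proof. by case=> y e; exists (f y); rewrite -rmorphM e rmorph1. Qed.

Lemma nilpotent_is_ideal (R : comPzRingType) : is_ideal (@nilpotent R).
Proof.
split=> [|x y [n xn] [m ym]|a x [n xn]]; first by exists 1%N; rewrite expr1.
- exists (n + m)%N; rewrite exprDn big1 // => i _.
  case: (leqP m i) => [lemi|ltim].
    by rewrite -(subnK lemi) exprD ym !mulr0 mul0rn.
  have len : (n <= n + m - i)%N by rewrite -addnBA ?leq_addr // ltnW.
  by rewrite -(subnK len) exprD xn mulr0 mul0r mul0rn.
- by exists n; rewrite exprMn xn mulr0.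
Qed.

Lemma invertible_1Dnilpotent (R : comPzRingType) (x : R) :
  nilpotent x -> invertible (1 + x).
Proof.
case=> n xn; exists (\sum_(i < n) (- x) ^+ i).
have := subrX1 (- x) n; rewrite exprNn xn mulr0 sub0r => /(congr1 -%R).
by rewrite opprK -mulNr opprB opprK.
Qed.

(** The localization at a is the standard etale algebra with P = X and g = a;
    the condition that P' = 1 divides g is void. *)
Lemma ex_localization (A : comPzRingType) (a : A) : (1 : A) <> 0 ->
  exists (B : comPzRingType) (phi : {rmorphism A -> B}),
  [/\ etale phi, invertible (phi a),
      forall (C : comPzRingType) (v : {rmorphism A -> C}),
        invertible (v a) ->
        exists h : {rmorphism B -> C}, forall x, h (phi x) = v x
    & (1 : B) = 0 -> nilpotent a].
Proof.
move=> n0; have [A' eA] := comNzRing_of n0; move: a {n0}; rewrite {}eA => a.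
have [|B [e [y [et eX ey univ B0]]]] :=
    @ex_std_etale A' 'X a%:P (monicX A').
  by exists a%:P; rewrite derivX mul1r.
exists B, (e \o polyC); split=> //; first by exists y.
- move=> C v [z vz]; have [f [fC fX]] := ex_poly_eval v 0.
  have [|h hE] := univ C f z fX; first by rewrite fC.
  by exists h => x; rewrite /= hE fC.
- move=> /B0 [k]; rewrite -rmorphXn rmodp_small => [/eqP|].
    by rewrite polyC_eq0 => /eqP ak; exists k.
  by rewrite size_polyX; apply: leq_ltn_trans (size_polyC_leq1 _) _.
Qed.

Lemma retraction_invertible (A B : comPzRingType) (phi : {rmorphism A -> B}) a :
  admits_retraction phi -> invertible (phi a) -> invertible a.
Proof. by case=> r rK /(rmorph_invertible r); rewrite rK. Qed.

(** The localization of K at u is etale over K: if it vanishes then u is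
    nilpotent, otherwise it has a retraction and u is invertible. *)
Lemma point_invertible_or_nilpotent (K : comPzRingType) (u : K) :
  is_point (@etale) K -> invertible u \/ nilpotent u.
Proof.
case=> n0 pointK; have [B [phi [et inv_u _ B0]]] := ex_localization u n0.
have [/B0|nB0] := pselect ((1 : B) = 0); first by right.
by left; apply: retraction_invertible inv_u; exact: pointK.
Qed.

Lemma local_ring_nonunits (A : comPzRingType) : (1 : A) <> 0 ->
    (forall a : A, invertible a \/ invertible (1 - a)) ->
  local_ring (fun a : A => ~ invertible a).
Proof.
move=> n0 dich; set m := fun a : A => _.
have proper J : is_ideal J -> ~ J 1 -> forall x, J x -> m x.
  by move=> [_ _ JM] J1 x Jx [y xy]; apply: J1; rewrite -xy mulrC; exact: JM.
have idm : is_ideal m.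
  split=> [[y]|x y nx ny [z]|a x nx /invertibleMl //].
    by rewrite mul0r => /esym.
  rewrite mulrDl => e; case: (dich (x * z)).
    by rewrite mulrC => /invertibleMl.
  by rewrite -e addrC addKr mulrC => /invertibleMl.
have m1 : ~ m 1 by apply; exists 1; rewrite mulr1.
split; first by split=> // J idJ J1 _; exact: proper.
move=> m' [idm' m'1 maxm'] x; split; first exact: proper.
by apply: maxm' => //; exact: proper.
Qed.

Lemma fieldType_of (Q : comPzRingType) : (1 : Q) <> 0 ->
    (forall x : Q, x <> 0 -> invertible x) ->
  exists k : fieldType, Q = k :> comPzRingType.
Proof.
move=> n0; have [Q' eQ] := comNzRing_of n0; rewrite {}eQ {n0 Q}.
case: Q' => T cls; set Q := GRing.ComNzRing.Pack cls => Qinv.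
have ex (x : Q) : exists y : Q, if x == 0 then y = 0 else x * y = 1.
  have [_|/eqP nx] := eqVneq x 0; first by exists 0.
  exact: Qinv.
have [inv invE] := choice ex.
have mulVf (x : Q) : x != 0 -> inv x * x = 1.
  by move=> nx; have := invE x; rewrite (negPf nx) mulrC.
have inv0 : inv 0 = 0 by have := invE 0; rewrite eqxx.
pose f := GRing.ComNzRing_isField.Build (GRing.ComNzRing.sort Q) mulVf inv0.
pose k : fieldType := HB.pack (GRing.ComNzRing.sort Q) f.
by exists k.
Qed.

Lemma ex_residue_field (A : comPzRingType) (m : A -> Prop) :
    maximal_ideal m ->
  exists (k : fieldType) (pi : {rmorphism A -> k}), is_residue_field m pi.
Proof.
case=> idm m1 maxm; have [Q [p [surj_p ker_p]]] := ex_ring_quotient idm.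
have Qinv (x : Q) : x <> 0 -> exists y, x * y = 1.
  have [a <-] := surj_p x => pa.
  have [I0 ID IM] := idm.
  (* The ideal m + A a, which contains 1 by maximality unless a is in m. *)
  pose J y := exists b, m (y - b * a).
  apply: contrapT => ninv; apply: pa; apply/ker_p.
  apply: (maxm J).
  - split=> [|y z [b yb] [c zc]|c y [b yb]].
    + by exists 0; rewrite mul0r subr0.
    + by exists (b + c); rewrite mulrDl opprD addrACA; exact: ID.
    + by exists (c * b); rewrite -mulrA -mulrBr; exact: IM.
  - case=> b /ker_p; rewrite rmorphB rmorphM rmorph1 => /eqP.
    rewrite subr_eq0 => /eqP e; apply: ninv; exists (p b).
    by rewrite mulrC -e.
  - by move=> y my; exists 0; rewrite mul0r subr0.
  - by exists 1; rewrite mul1r subrr.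
have n0 : (1 : Q) <> 0 by rewrite -(rmorph1 p) => /ker_p.
have [k eQ] := fieldType_of n0 Qinv.
by move: p surj_p ker_p {Qinv n0}; rewrite {}eQ => p; exists k, p.
Qed.

Section LocalObject.
Variable A : comPzRingType.
Hypothesis locA : local_object (@etale) A.

Let m (a : A) : Prop := ~ invertible a.

(** The zero ring has no map to a point, hence is covered by the empty
    family. *)
Lemma local_object_nonzero : (1 : A) <> 0.
Proof.
move=> e0.
have [|[]] := locA (I := void) (A_ := fun=> A) (f := fun=> idfun).
split=> [[]|K u [n0 _]]; case: n0.
by rewrite -(rmorph1 u) e0 rmorph0.
Qed.

Lemma local_object_local_ring : local_ring m.
Proof.
have n0 := local_object_nonzero; apply: local_ring_nonunits => // a.
have [B [phi [et inv_a univ _]]] := ex_localization a n0.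
have [B' [phi' [et' inv_a' univ' _]]] := ex_localization (1 - a) n0.
have [|[] ret] := locA (I := bool) (A_ := fun b => if b then B else B')
  (f := fun b => if b return {rmorphism A -> if b then B else B'}
                 then phi else phi').
- split=> [[]//|K u pointK].
  have [inv_u|nil_u] := point_invertible_or_nilpotent (u a) pointK.
    by have [h hE] := univ K u inv_u; exists true, h.
  have [|h hE] := univ' K u; last by exists false, h.
  rewrite rmorphB rmorph1; apply: invertible_1Dnilpotent.
  have [_ _ IM] := nilpotent_is_ideal K.
  by rewrite -mulN1r; exact: IM.
- by left; apply: retraction_invertible ret _.
- by right; apply: retraction_invertible ret _.
Qed.

(** The covering family consists of phi and of the localizations of A at the
    elements of m, which admit no retraction. In a point K that makes none of
    these elements invertible they are all nilpotent, and a compatible pair of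
    maps to a nonzero ring C shows that K (x)_A B is nonzero; since it is etale
    over K, it retracts onto K. *)
Lemma local_object_retraction (B : comPzRingType) (phi : {rmorphism A -> B}) :
    etale phi ->
    (forall (K : comPzRingType) (u : {rmorphism A -> K}), (1 : K) <> 0 ->
       (forall a, m a -> nilpotent (u a)) ->
     exists (C : comPzRingType) (v : {rmorphism K -> C})
            (w : {rmorphism B -> C}),
       (1 : C) <> 0 /\ forall a, v (u a) = w (phi a)) ->
  admits_retraction phi.
Proof.
move=> et_phi exC; have n0 := local_object_nonzero.
pose good a (p : {B' : comPzRingType & {rmorphism A -> B'}}) :=
  [/\ etale (projT2 p), invertible (projT2 p a)
    & forall (C : comPzRingType) (v : {rmorphism A -> C}),
        invertible (v a) ->
        exists h : {rmorphism projT1 p -> C}, forall x, h (projT2 p x) = v x].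
have exloc a : exists p, good a p.
  by have [B' [phi' []]] := ex_localization a n0; exists (existT _ B' phi').
have [loc locE] := choice exloc.
pose I := option {a : A | m a}.
pose A_ (i : I) : comPzRingType :=
  if i is Some a then projT1 (loc (sval a)) else B.
pose f (i : I) : {rmorphism A -> A_ i} :=
  if i is Some a then projT2 (loc (sval a)) else phi.
have [|[a|]] := locA (I := I) (A_ := A_) (f := f); last by [].
  split=> [[a|]//|K u pointK]; first by case: (locE (sval a)).
  have [[a [ma inv_a]]|noinv] := pselect (exists a, m a /\ invertible (u a)).
    have [_ _ univ] := locE a; have [h hE] := univ K u inv_a.
    by exists (Some (exist _ a ma)), h.
  have nil_u a : m a -> nilpotent (u a).
    move=> ma; have [inv_a|//] := point_invertible_or_nilpotent (u a) pointK.
    by case: noinv; exists a.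
  have [T [i [j tensT]]] := ex_tensor_ring u phi.
  have [ij _ _] := tensT.
  have [C [v [w [C0 vw]]]] := exC K u pointK.1 nil_u.
  have [g _] := tensor_ring_pushout tensT vw.
  have T0 : (1 : T) <> 0.
    by move=> e; apply: C0; rewrite -(rmorph1 g) e rmorph0.
  have [r rK] := pointK.2 T i (etale_base_change tensT et_phi) T0.
  by exists None, (r \o j) => a /=; rewrite -ij rK.
move=> ret; case: (svalP a); have [_ inv_a _] := locE (sval a).
exact: retraction_invertible ret inv_a.
Qed.

(** Every b in B is congruent modulo n to the image of some a in A, unique
    modulo m. As m is nilpotent in K, sending b to the class of a is a
    well-defined map from B to K modulo its nilradical. *)
Lemma local_object_henselian : henselian m.
Proof.
have locm := local_object_local_ring.
split=> // B phi et [n [[idn n1 _] over res]].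
have [n0 nD nM] := idn.
apply: local_object_retraction et _ => K u K0 nil_u.
have [C [p [surj_p ker_p]]] := ex_ring_quotient (nilpotent_is_ideal K).
have [s sE] := choice res.
have well a b : n (b - phi a) -> p (u a) = p (u (s b)).
  move=> nb; apply/eqP; rewrite -subr_eq0 -!rmorphB; apply/eqP/ker_p/nil_u.
  apply/over; rewrite rmorphB -(subrKA b) addrC.
  apply: nD; first exact: sE.
  by rewrite -opprB -mulN1r; exact: nM.
have [|||w wE] := @ex_rmorphism B C (fun b => p (u (s b))).
- by rewrite -(well 1) ?rmorph1 ?subrr.
- move=> b b'; rewrite -!rmorphD; apply/esym/well.
  by rewrite rmorphD opprD addrACA; exact: nD.
- move=> b b'; rewrite -!rmorphM; apply/esym/well.
  rewrite rmorphM -(subrKA (phi (s b) * b')) -mulrBl -mulrBr.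
  by apply: nD; [rewrite mulrC|]; exact: nM.
exists C, p, w; split.
  rewrite -(rmorph1 p) => /ker_p [k]; rewrite expr1n; exact: K0.
by move=> a; rewrite wE; apply: well; rewrite subrr.
Qed.

End LocalObject.

Lemma lift_poly (A k : comNzRingType) (pi : {rmorphism A -> k})
    (q : {poly k}) :
  surjective pi -> exists Q : {poly A}, map_poly pi Q = q.
Proof.
move=> /surjective_section [s sK]; exists (\poly_(i < size q) s q`_i).
apply/polyP => i; rewrite coef_map coef_poly /=.
case: ltnP => [_|leqi]; first exact: sK.
by rewrite rmorph0 nth_default.
Qed.

Lemma lift_monic_poly (A k : comNzRingType)
    (pi : {rmorphism A -> k}) (q : {poly k}) :
    surjective pi -> q \is monic ->
  exists2 Q : {poly A}, Q \is monic & map_poly pi Q = q /\ size Q = size q.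
Proof.
move=> /surjective_section [s sK] monq; pose d := (size q).-1.
have sq : size q = d.+1.
  by rewrite prednK // size_poly_gt0 monic_neq0.
pose L : {poly A} := \poly_(i < d) s q`_i.
have ltd : (size L < size ('X^d : {poly A}))%N.
  by rewrite size_polyXn ltnS size_poly.
exists ('X^d + L).
  by rewrite monicE lead_coefDl // lead_coefXn.
split; last by rewrite size_polyDl // size_polyXn sq.
apply/polyP => i; rewrite coef_map coefD coefXn coef_poly /=.
case: (ltngtP i d) => [ltid|ltdi|->] /=; rewrite ?add0r ?addr0 ?sK //.
  by rewrite rmorph0 nth_default // sq.
by have := eqP monq; rewrite rmorph1 /lead_coef => <-.
Qed.

Lemma monic_proper_ideal (K : comNzRingType) (P : {poly K}) :
    P \is monic -> (1 < size P)%N ->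
  exists (C : comPzRingType) (p : {rmorphism {poly K} -> C}),
    p P = 0 /\ (1 : C) <> 0.
Proof.
move=> monP gt1.
have idP : is_ideal (fun F : {poly K} => exists c, F = c * P).
  split=> [|_ _ [c ->] [d ->]|a _ [c ->]].
  - by exists 0; rewrite mul0r.
  - by exists (c + d); rewrite mulrDl.
  - by exists (a * c); rewrite mulrA.
have [C [p [_ ker_p]]] := ex_ring_quotient idP; exists C, p; split.
  by apply/ker_p; exists 1; rewrite mul1r.
rewrite -(rmorph1 p) => /ker_p [c /(congr1 (fun F => rmodp F P))].
rewrite rmodp_mull // rmodp_small ?size_polyC ?oner_eq0 //.
by move/eqP; rewrite oner_eq0.
Qed.

Lemma poly_eval_nilpotent (A : comNzRingType) (C : comPzRingType)
    (f : {rmorphism {poly A} -> C}) (W : {poly A}) :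
  (forall i, nilpotent (f (W`_i)%:P)) -> nilpotent (f W).
Proof.
move=> nilW; have [I0 ID IM] := nilpotent_is_ideal C.
rewrite -[W]coefK poly_def rmorph_sum; elim/big_ind: _ => // i _.
by rewrite -mul_polyC rmorphM mulrC; apply: IM; exact: nilW.
Qed.

(** A Bezout relation for the separable polynomial lifts to U P + V P' = 1 + W
    where W has its coefficients in m. In K[X]/(P), which is nonzero because P
    is monic and not constant, W is nilpotent and P' therefore invertible. *)
Lemma local_object_separably_closed (A : comPzRingType) (k : fieldType)
    (pi : {rmorphism A -> k}) :
    local_object (@etale) A ->
    is_residue_field (fun a : A => ~ invertible a) pi ->
  separably_closed k.
Proof.
move=> locA; have [A' eA] := comNzRing_of (local_object_nonzero locA).
move: pi locA; rewrite {}eA => {A} pi locA [surj_pi ker_pi] q sep_q gt1.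
have /Bezout_eq1_coprimepP [[u v] /= bez] : coprimep q q^`().
  by rewrite unlock in sep_q.
have q0 : q != 0 by rewrite -size_poly_gt0 ltnW.
(* The lift has to be monic, so q is first divided by c. *)
pose c := lead_coef q; have c0 : c != 0 by rewrite lead_coef_eq0.
pose p := c^-1 *: q; have qE : q = c *: p by rewrite scalerA divff ?scale1r.
have monp : p \is monic by rewrite monicE lead_coefZ mulVf.
have [P monP [piP sP]] := lift_monic_poly surj_pi monp.
have [U piU] := lift_poly (c *: u) surj_pi.
have [V piV] := lift_poly (c *: v) surj_pi.
have gt1P : (1 < size P)%N by rewrite sP size_scale ?invr_eq0.
pose W := U * P + V * P^`() - 1.
have nonunitW i : ~ invertible W`_i.
  apply/ker_pi; rewrite -coef_map /W rmorphB rmorphD !rmorphM /= -deriv_map.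
  rewrite piU piV piP rmorph1 -!scalerAl !scalerAr -derivZ -qE bez.
  by rewrite subrr coef0.
have [|B [e [y [et eP ey univ _]]]] := @ex_std_etale A' P P^`() monP.
  by exists 1; rewrite mulr1.
have [|r rK] := local_object_retraction locA et.
  move=> K w K0 nil_w; have [K' eK] := comNzRing_of K0.
  move: w nil_w {K0}; rewrite {}eK => {K} w nil_w.
  have [||C [h [hP C0]]] := @monic_proper_ideal K' (map_poly w P).
  - exact: monic_map.
  - by rewrite size_map_poly_id0 // (eqP monP) rmorph1 oner_neq0.
  pose f : {rmorphism {poly A'} -> C} := h \o map_poly w.
  have [z fz] : invertible (f P^`()).
    have := poly_eval_nilpotent (f := f) (W := W).
    case=> [i|n fW0].
      have [n wn0] := nil_w _ (nonunitW i); exists n.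
      by rewrite /= map_polyC -(rmorphXn h) -polyC_exp wn0 !rmorph0.
    have /invertible_1Dnilpotent : nilpotent (f W) by exists n.
    rewrite rmorphB rmorphD !rmorphM rmorph1 addrC subrK /= hP mulr0 add0r.
    exact: invertibleMl.
  have [g gE] := univ C f z hP fz.
  by exists C, (h \o polyC), g; split=> // a; rewrite gE /= map_polyC.
pose x := r (e 'X); exists (pi x).
rewrite qE rootZ // -piP /root horner_map; apply/eqP.
suff -> : P.[x] = 0 by rewrite rmorph0.
have <- : r (e P) = P.[x]; last by rewrite eP rmorph0.
apply: (poly_rmorph_ext (e := r \o e) (e' := horner_eval x)) => [a|] /=.
  by rewrite /horner_eval hornerC; exact: rK.
by rewrite /horner_eval hornerX.
Qed.

Lemma local_object_strictly_henselian (A : comPzRingType) :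
  local_object (@etale) A -> exists m : A -> Prop, strictly_henselian m.
Proof.
move=> locA; exists (fun a => ~ invertible a).
have hens := local_object_henselian locA; split=> //.
have [k [pi resk]] := ex_residue_field hens.1.1.
by exists k, pi; split=> //; exact: local_object_separably_closed resk.
Qed.

(** * Maximal submodules and linear functionals *)

Definition is_submodule (R : pzRingType) (M : lmodType R) (S : M -> Prop) :=
  [/\ S 0, forall x y, S x -> S y -> S (x + y)
    & forall a x, S x -> S (a *: x)].

(** Common source of maximal ideals (M = R and x = 1) and of linear forms
    (over a field, W is a hyperplane complementary to x). *)
Lemma ex_maximal_submodule (R : pzRingType) (M : lmodType R) (S : M -> Prop)
    (x : M) :
    is_submodule S -> ~ S x ->
  exists W : M -> Prop,
    [/\ is_submodule W, forall y, S y -> W y, ~ W x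
      & forall y, ~ W y -> exists a, W (x - a *: y)].
Proof.
move=> subS nSx.
pose good (W : M -> Prop) :=
  [/\ is_submodule W, forall y, S y -> W y & ~ W x].
pose T := {W : M -> Prop | good W}.
pose le (U V : T) := `[< forall y, sval U y -> sval V y >].
have [||C chainC|[W [subW SW nWx]] maxW] :=
    @ZL_preorder T (exist _ S (And3 subS (fun y (Sy : S y) => Sy) nSx)) le.
- by move=> U; apply/asboolP.
- by move=> U V W /asboolP UV /asboolP VW; apply/asboolP => y /UV /VW.
- have [[U0 CU0]|noC] := pselect (exists U, C U); last first.
    exists (exist _ S (And3 subS (fun y (Sy : S y) => Sy) nSx)) => U CU.
    by case: noC; exists U.
  pose W y := exists U, C U /\ sval U y.
  have goodW : good W.
    split; last 1 first.
    + by case=> U [_]; case: (svalP U).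
    + split.
      * by exists U0; split=> //; case: (svalP U0) => -[].
      * move=> y z [U [CU Uy]] [V [CV Vz]].
        case: (chainC U V CU CV) => /asboolP UV.
          exists V; split=> //; case: (svalP V) => -[_ VD _] _ _.
          exact: VD (UV _ Uy) Vz.
        exists U; split=> //; case: (svalP U) => -[_ UD _] _ _.
        exact: UD Uy (UV _ Vz).
      * move=> a y [U [CU Uy]]; exists U; split=> //.
        by case: (svalP U) => -[_ _ UZ] _ _; exact: UZ.
    + by move=> y Sy; exists U0; split=> //; case: (svalP U0) => _ + _; exact.
  by exists (exist _ W goodW) => U CU; apply/asboolP => y Uy; exists U.
exists W; split=> // y nWy; apply: contrapT => noa.
have [W0 WD WZ] := subW.
pose V z := exists a, W (z - a *: y).
have WV z : W z -> V z by exists 0; rewrite scale0r subr0.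
have goodV : good V.
  split=> [|z /SW|[a]]; [|exact: WV|by move=> Wxa; apply: noa; exists a].
  split=> [|z t [a Wz] [b Wt]|c z [a Wz]]; first exact: WV.
  - by exists (a + b); rewrite scalerDl opprD addrACA; exact: WD.
  - by exists (c * a); rewrite -scalerA -scalerBr; exact: WZ.
have /asboolP /= VW := maxW (exist _ V goodV) (asboolT WV).
by apply/nWy/VW; exists 1; rewrite scale1r subrr.
Qed.

Lemma ex_maximal_ideal (B : comPzRingType) : (1 : B) <> 0 ->
  exists n : B -> Prop, maximal_ideal n.
Proof.
move=> n0.
have [||W [[W0 WD WZ] _ W1 maxW]] :=
    @ex_maximal_submodule B B^o (fun x => x = 0) 1.
- by split=> [|x y -> ->|a x ->]; rewrite ?addr0 ?scaler0.
- exact: n0.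
exists W; split=> // J [J0 JD JM] J1 WJ x Jx; apply: contrapT => nWx.
have [a Wa] := maxW x nWx; apply: J1.
rewrite -[1](subrK (a * x)); apply: JD; last exact: JM.
exact: WJ.
Qed.

(** The form is the coordinate along x modulo a submodule W that is maximal
    among those that contain S but not x. *)
Lemma ex_functional (k : fieldType) (M : lmodType k) (S : M -> Prop) (x : M) :
    is_submodule S -> ~ S x ->
  exists f : M -> k,
    [/\ {morph f : y z / y + z}, forall c y, f (c *: y) = c * f y,
        forall y, S y -> f y = 0 & f x = 1].
Proof.
move=> subS nSx.
have [W [[W0 WD WZ] SW nWx maxW]] := ex_maximal_submodule subS nSx.
have WB y z : W y -> W z -> W (y - z).
  by move=> Wy /(WZ (-1)); rewrite scaleN1r; exact: WD.
have ex y : exists c, W (y - c *: x).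
  have [Wy|nWy] := pselect (W y); first by exists 0; rewrite scale0r subr0.
  have [a Wa] := maxW y nWy; exists a^-1.
  have na : a != 0.
    by apply/eqP => a0; apply: nWx; rewrite a0 scale0r subr0 in Wa.
  have := WZ (- a^-1) _ Wa.
  by rewrite scalerBr scalerA mulNr mulVf // scaleN1r opprK addrC scaleNr.
have [f fE] := choice ex.
have uniq y c : W (y - c *: x) -> f y = c.
  move=> Wc; apply/eqP; apply: contrapT => /negP nc; apply: nWx.
  have := WB _ _ Wc (fE y).
  rewrite opprB addrC subrKA -scalerBl => /(WZ (f y - c)^-1).
  by rewrite scalerA mulVf ?scale1r // subr_eq0.
exists f; split=> [y z|c y|y Sy|]; apply: uniq.
- by rewrite scalerDl opprD addrACA; exact: WD.
- by rewrite -scalerA -scalerBr; exact: WZ.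
- by rewrite scale0r subr0; exact: SW.
- by rewrite scale1r subrr.
Qed.

(** * The tensor square of a field extension *)

(** Stated with l%:R = 0 since [pchar] presupposes a nonzero ring. *)
Lemma frobenius_sub (R : comPzRingType) (l : nat) (x y : R) :
  prime l -> l%:R = 0 :> R -> (x - y) ^+ l = x ^+ l - y ^+ l.
Proof.
move=> pr_l l0; have [e0|n0] := pselect ((1 : R) = 0).
  exact: zero_ring.
have [R' eR] := comNzRing_of n0; move: x y l0 {n0}; rewrite {}eR => x y l0.
have ch : l \in [pchar R'] by rewrite inE /= pr_l l0 eqxx.
by have := pFrobenius_autB_comm ch (mulrC x y); rewrite !pFrobenius_autE.
Qed.

Section FieldTensor.
Variables (k L : fieldType) (psi : {rmorphism k -> L}) (T : comPzRingType).
Variables (i j : {rmorphism L -> T}).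
Hypothesis tensT : is_tensor_ring psi psi i j.

Definition functional (f : L -> k) : Prop :=
  {morph f : x y / x + y} /\ forall c x, f (psi c * x) = c * f x.

(** A linear form f applied to the second factor. *)
Lemma functional_contraction (f : L -> k) : functional f ->
  exists F : {additive T -> L},
    (forall a b, F (i a * j b) = a * psi (f b)) /\
    (forall a z, F (i a * z) = a * F z).
Proof.
case=> fD fZ.
have [|F FE] := @tensor_ring_additive _ _ _ _ _ _ _ _ tensT L
    (fun a b => a * psi (f b)).
  split=> [a a' b|a b b'|c a b]; first by rewrite mulrDl.
    by rewrite fD rmorphD mulrDr.
  by rewrite fZ rmorphM mulrA [a * _]mulrC.
exists F; split=> // a z; elim/(tensor_ring_ind tensT): z => [|x y e e'|b c].
- by rewrite mulr0 !raddf0 mulr0.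
- by rewrite mulrDr !raddfD e e' mulrDr.
- by rewrite mulrA -rmorphM !FE mulrA.
Qed.

Lemma ex_field_functional (S : L -> Prop) (x : L) :
    S 0 -> (forall y z, S y -> S z -> S (y + z)) ->
    (forall c y, S y -> S (psi c * y)) -> ~ S x ->
  exists f : L -> k, [/\ functional f, forall y, S y -> f y = 0 & f x = 1].
Proof.
move=> S0 SD SZ nSx.
have [//|//|f [fD fZ f0 f1]] := @ex_functional k (restr psi L^o) S x.
by exists f; split=> //; split=> // c y; exact: (fZ c y).
Qed.

(** A tensor is written with as few terms as possible: if the first right
    factor is a combination of the others, its term is distributed over them.
    Otherwise a linear form equal to 1 on it and to 0 on the others contracts
    the tensor to the first left factor, and a term whose left factor is zero
    can be dropped. *)
Lemma nonzero_contraction n (a b : 'I_n -> L) :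
    \sum_(h < n) i (a h) * j (b h) <> 0 ->
  exists f, functional f /\ \sum_(h < n) a h * psi (f (b h)) <> 0.
Proof.
elim: n a b => [|n IH] a b; first by rewrite big_ord0.
pose b' h := b (lift ord0 h).
pose S y := exists c : 'I_n -> k, y = \sum_(h < n) psi (c h) * b' h.
have [[c b0E]|nS] := pselect (S (b ord0)).
  have E : \sum_(h < n.+1) i (a h) * j (b h) =
      \sum_(h < n) i (a (lift ord0 h) + psi (c h) * a ord0) * j (b' h).
    have [ij _ _] := tensT.
    rewrite big_ord_recl b0E rmorph_sum mulr_sumr -big_split /=.
    apply: eq_bigr => h _; rewrite rmorphD mulrDl addrC; congr (_ + _).
    by rewrite !rmorphM -ij mulrA [i (psi _) * _]mulrC.
  rewrite E => /IH [f [[fD fZ] nz]]; exists f; split=> //.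
  rewrite big_ord_recl; move: nz; congr (_ <> _).
  rewrite b0E (big_morph f fD (additive0 fD)) rmorph_sum mulr_sumr.
  rewrite -big_split /=.
  apply: eq_bigr => h _; rewrite mulrDl addrC; congr (_ + _).
  by rewrite fZ rmorphM mulrA [psi _ * a _]mulrC.
have [||| |f [funf f0 f1]] := @ex_field_functional S (b ord0).
- by exists (fun=> 0); rewrite big1 // => h _; rewrite rmorph0 mul0r.
- move=> _ _ [c ->] [d ->]; exists (fun h => c h + d h).
  by rewrite -big_split; apply: eq_bigr => h _; rewrite rmorphD mulrDl.
- move=> c _ [d ->]; exists (fun h => c * d h).
  by rewrite mulr_sumr; apply: eq_bigr => h _; rewrite rmorphM mulrA.
- exact: nS.
have [a0|na0 _] := eqVneq (a ord0) 0.
  rewrite big_ord_recl a0 rmorph0 mul0r add0r => /IH [g [fung nz]].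
  by exists g; split=> //; rewrite big_ord_recl a0 mul0r add0r.
exists f; split=> //; rewrite big_ord_recl f1 rmorph1 mulr1 big1 => [|h _].
  by rewrite addr0; apply/eqP.
rewrite f0 ?rmorph0 ?mulr0 //; exists (fun h' => (h' == h)%:R).
rewrite (bigD1 h) //= eqxx rmorph1 mul1r big1 ?addr0 //.
by move=> h' /negPf ->; rewrite rmorph0 mul0r.
Qed.

(** If x is not in k, a linear form that kills k but not x contracts x (x) 1 to
    0 and 1 (x) x to a nonzero element. *)
Lemma tensor_fst_eq_snd x : i x = j x -> exists c, psi c = x.
Proof.
move=> ijx; apply: contrapT => nx.
have [||||f [funf f0 f1]] := @ex_field_functional
    (fun y => exists c, psi c = y) x.
- by exists 0; rewrite rmorph0.
- by move=> _ _ [c <-] [d <-]; exists (c + d); rewrite rmorphD.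
- by move=> c _ [d <-]; exists (c * d); rewrite rmorphM.
- exact: nx.
have [F [FE _]] := functional_contraction funf.
have Fi : F (i x) = 0.
  rewrite -[i x]mulr1 -(rmorph1 j) FE f0 ?rmorph0 ?mulr0 //.
  by exists 1; rewrite rmorph1.
have Fj : F (j x) = 1.
  by rewrite -[j x]mul1r -(rmorph1 i) FE f1 rmorph1 mulr1.
by have /eqP := Fj; rewrite -ijx Fi eq_sym oner_eq0.
Qed.

(** Write e as the sum of the a_h (x) b_h and let c be a nonzero contraction of
    it by f. Contracting the equality of (y (x) 1) e and (1 (x) y) e shows that
    y c is the combination of the a_h with coefficients f (b_h y). So the a_h
    span L over k, and x is an eigenvalue of the matrix over k by which it acts
    on them. *)
Lemma algebraic_of_separability_element (e : T) :
    e <> 0 -> (forall x, e * i x = e * j x) ->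
  forall x, exists2 p : {poly k}, p != 0 & root (map_poly psi p) x.
Proof.
move=> e0 eE x; have [_ genT _] := tensT; have [s sE] := genT e.
have [n [a [b eab]]] : exists n (a b : 'I_n -> L),
    e = \sum_(h < n) i (a h) * j (b h).
  exists (size s), (fun h => (nth (0, 0) s h).1), (fun h => (nth (0, 0) s h).2).
  by rewrite sE /tensor_sum (big_nth (0, 0)) big_mkord.
have [f [funf nz]] : exists f, functional f /\
    \sum_(h < n) a h * psi (f (b h)) <> 0.
  by apply: nonzero_contraction; rewrite -eab.
have [F [FE Fi]] := functional_contraction funf.
pose c := F e.
have cE : c = \sum_(h < n) a h * psi (f (b h)).
  by rewrite /c eab raddf_sum; apply: eq_bigr => h _; exact: FE.
have spanE y : y * c = \sum_(h < n) a h * psi (f (b h * y)).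
  rewrite /c -Fi mulrC eE eab mulr_suml raddf_sum; apply: eq_bigr => h _.
  by rewrite -mulrA -rmorphM FE.
have c0 : c != 0 by apply/eqP; rewrite cE.
pose M := \matrix_(h < n, l < n) f (b h * (x * a l / c)).
pose v := \row_(h < n) a h.
have vM : v *m map_mx psi M = x *: v.
  apply/rowP => l; rewrite !mxE.
  have -> : x * a l = (x * a l / c) * c by rewrite mulfVK.
  by rewrite spanE; apply: eq_bigr => h _; rewrite !mxE.
have v0 : v != 0.
  apply/eqP => v0; case: nz; apply: big1 => h _.
  have := congr1 (fun w : 'rV_n => w 0 h) v0.
  by rewrite !mxE => ->; rewrite mul0r.
exists (char_poly M); first exact: monic_neq0 (char_poly_monic M).
rewrite map_char_poly -eigenvalue_root_char.
by apply/eigenvalueP; exists v.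
Qed.

(** By induction on the degree of p. If p is separable it has a root c in k,
    and either x = c or x is a root of a polynomial of lower degree. If
    gcd (p, p') is a proper factor, x is a root of it or of its cofactor. In
    the remaining case p' = 0, so p = h (X^l) with l the characteristic, and
    x^l is a root of h, while (x (x) 1 - 1 (x) x)^l is x^l (x) 1 - 1 (x) x^l. *)
Lemma algebraic_nilpotent (sep_k : separably_closed k) n (p : {poly k}) x :
    (size p <= n)%N -> p != 0 -> root (map_poly psi p) x ->
  nilpotent (i x - j x).
Proof.
have [ij _ _] := tensT.
elim: n p x => [|n IH] p x lepn p0 px.
  by rewrite -size_poly_eq0 -leqn0 lepn in p0.
have gt1 : (1 < size p)%N.
  rewrite ltnNge; apply/negP => /size1_polyC pE; case/negP: p0.
  by move: px; rewrite pE map_polyC rootC fmorph_eq0 => /eqP ->.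
have factor d s : p = d * s -> (size d < size p)%N -> (size s < size p)%N ->
    nilpotent (i x - j x).
  move=> pE sd ss.
  have ds0 : d * s != 0 by rewrite -pE.
  have [d0 s0] : d != 0 /\ s != 0.
    by move: ds0; rewrite mulf_eq0 negb_or => /andP.
  move: px; rewrite pE rmorphM rootM => /orP[rd|rs].
  - by apply: IH d0 rd; exact: leq_trans sd lepn.
  - by apply: IH s0 rs; exact: leq_trans ss lepn.
have [cop|ncop] := boolP (coprimep p p^`()).
  have [|c /factor_theorem[s pE]] := sep_k p _ gt1; first by rewrite unlock.
  have s0 : s != 0 by apply: contraNneq p0 => s0; rewrite pE s0 mul0r.
  have sp : size p = (size s).+1.
    by rewrite pE size_Mmonic ?monicXsubC // size_XsubC addn2.
  move: px; rewrite pE rmorphM rootM => /orP[rs|].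
    by apply: IH s0 rs; rewrite -ltnS -sp.
  rewrite /= map_polyXsubC root_XsubC => /eqP ->.
  by exists 1%N; rewrite ij subrr expr1.
have [dp0|ndp0] := eqVneq p^`() 0; last first.
  pose d := gcdp p p^`().
  have dvd_p : d %| p by exact: dvdp_gcdl.
  have sd : (size d < size p)%N.
    apply: leq_ltn_trans (dvdp_leq ndp0 (dvdp_gcdr _ _)) _.
    exact: lt_size_deriv.
  have d_gt1 : (1 < size d)%N.
    rewrite ltn_neqAle size_poly_gt0 gcdp_eq0 negb_and p0 andbT eq_sym.
    by rewrite coprimep_def in ncop.
  have pE : p = d * (p %/ d) by rewrite mulrC divpK.
  apply: (factor d (p %/ d)) => //.
  rewrite size_divp ?ltn_subrL; last by rewrite -size_poly_gt0 ltnW.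
  by rewrite -subn1 subn_gt0 d_gt1 size_poly_gt0.
pose d := (size p).-1; have d_gt0 : (0 < d)%N by rewrite -ltnS prednK // ltnW.
have coef0_deriv m : (0 < m)%N -> p`_m *+ m = 0.
  by case: m => // m _; rewrite -coef_deriv dp0 coef0.
have [l lchar] : exists l, l \in [pchar k].
  apply: (natf0_pchar d_gt0).
  have /eqP := coef0_deriv d d_gt0; rewrite -[p`_d *+ d]mulr_natr.
  by rewrite mulf_eq0 -[p`_d]/(lead_coef p) lead_coef_eq0 (negPf p0).
have /andP[pr_l /eqP l0] := lchar.
have l_gt0 := prime_gt0 pr_l.
pose h := \poly_(m < size p) p`_(m * l).
have pE : p = h \Po 'X^l.
  apply/polyP => m; rewrite coef_comp_poly_Xn //.
  case: ifP => [ldvd|/negbT ldvd].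
    rewrite coef_poly divnK //; case: ltnP => // lem.
    by rewrite nth_default // (leq_trans lem) // leq_div.
  have m_gt0 : (0 < m)%N by case: m ldvd => //; rewrite dvdn0.
  have /eqP := coef0_deriv m m_gt0; rewrite -[p`_m *+ m]mulr_natr.
  by rewrite mulf_eq0 -(dvdn_pcharf lchar) (negPf ldvd) orbF => /eqP.
have h0 : h != 0 by apply: contraNneq p0 => h0; rewrite pE h0 comp_poly0.
have sh : (size h < size p)%N.
  have := size_comp_poly h 'X^l; rewrite -pE size_polyXn /= => e.
  have h_gt0 : (0 < size h)%N by rewrite size_poly_gt0.
  rewrite -(prednK h_gt0) -(prednK (ltnW gt1)) ltnS e ltn_Pmulr ?prime_gt1 //.
  by move: d_gt0; rewrite /d e muln_gt0 => /andP[].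
have [m e0] : nilpotent (i (x ^+ l) - j (x ^+ l)).
  apply: (IH h) h0 _; first exact: leq_trans sh lepn.
  move: px; rewrite {1}pE map_comp_poly map_polyXn /root horner_comp.
  by rewrite hornerXn.
exists (l * m)%N; rewrite exprM frobenius_sub // -?rmorphXn //.
by rewrite -(rmorph_nat i) -(rmorph_nat psi) l0 !rmorph0.
Qed.

End FieldTensor.

(** * Separably closed fields are points *)

(** Generation is only used through the uniqueness of maps that it implies. *)
Definition generated_by (A B : comPzRingType) (phi : {rmorphism A -> B})
    (n : nat) (x : 'I_n -> B) : Prop :=
  forall (C : comPzRingType) (g h : {rmorphism B -> C}),
    (forall a, g (phi a) = h (phi a)) -> (forall l, g (x l) = h (x l)) ->
  g =1 h.

Lemma finitely_presented_generated (A B : comPzRingType)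
    (phi : {rmorphism A -> B}) :
  finitely_presented phi -> exists n (x : 'I_n -> B), generated_by phi x.
Proof.
case=> n [P [iota [X [q [polyP qE surj_q _]]]]].
exists n, (q \o X) => C g h gh ghx b; have [y <-] := surj_q b.
have [_ uniq] := polyP C (g \o phi) (g \o q \o X).
by apply: (uniq (g \o q) (h \o q)) => [a|l] /=; rewrite ?qE ?gh ?ghx.
Qed.

Section SeparabilityElement.
Variables (A B T : comPzRingType) (phi : {rmorphism A -> B}).
Variables (i j : {rmorphism B -> T}).
Hypothesis tensT : is_tensor_ring phi phi i j.
Variables (mu : {rmorphism T -> B}).
Hypotheses (mui : forall b, mu (i b) = b) (muj : forall b, mu (j b) = b).
Variables (n : nat) (x : 'I_n -> B).
Hypothesis gen_x : generated_by phi x.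

Let delta h := i (x h) - j (x h).

Lemma mu_delta h : mu (delta h) = 0.
Proof. by rewrite rmorphB mui muj subrr. Qed.

(** Modulo the delta h the two maps from B to T agree on A and on the
    generators x, hence everywhere; so every z is congruent to mu z (x) 1. *)
Lemma kernel_mul z : mu z = 0 -> exists c, z = \sum_(h < n) c h * delta h.
Proof.
have [D [p [_ ker_p]]] := ex_ring_quotient (span_is_ideal delta).
have ijE b : p (i b) = p (j b).
  have [ij _ _] := tensT.
  apply: (gen_x (g := p \o i) (h := p \o j)) => [a|h] /=; first by rewrite ij.
  apply/eqP; rewrite -subr_eq0 -rmorphB; apply/eqP/ker_p.
  exists (fun l => (l == h)%:R); rewrite (bigD1 h) //= eqxx mul1r.
  by rewrite big1 ?addr0 // => l /negPf ->; rewrite mul0r.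
have pE t : p t = p (i (mu t)).
  elim/(tensor_ring_ind tensT): t => [|t t' e e'|b c].
  - by rewrite !rmorph0.
  - by rewrite !rmorphD e e'.
  - by rewrite !rmorphM mui muj -ijE.
by move=> mz; apply/ker_p; rewrite pE mz !rmorph0.
Qed.

Hypothesis unr : formally_unramified phi.

(** With J the kernel of mu, the two maps from B to T/J^2 have the same
    composite with T/J^2 -> B, whose kernel has square zero; as B is unramified
    over A they agree, which puts the delta h in J^2. *)
Lemma kernel_mul_square h : exists2 u : 'I_n -> T,
  delta h = \sum_(l < n) u l * delta l & forall l, mu (u l) = 0.
Proof.
pose J2 z := exists2 u : 'I_n -> T,
  z = \sum_(l < n) u l * delta l & forall l, mu (u l) = 0.
have idJ2 : is_ideal J2.
  split=> [|_ _ [u -> mu0] [v -> mv0]|a _ [u -> mu0]].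
  - exists (fun=> 0) => [|l]; last exact: rmorph0.
    by rewrite big1 // => l _; rewrite mul0r.
  - exists (fun l => u l + v l) => [|l]; last by rewrite rmorphD mu0 mv0 addr0.
    by rewrite -big_split; apply: eq_bigr => l _; rewrite mulrDl.
  - exists (fun l => a * u l) => [|l]; last by rewrite rmorphM mu0 mulr0.
    by rewrite mulr_sumr; apply: eq_bigr => l _; rewrite mulrA.
have [C [p [surj_p ker_p]]] := ex_ring_quotient idJ2.
have [z /ker_p [u -> _]|r rE] := quotient_factor (f := mu) surj_p.
  by rewrite rmorph_sum big1 // => l _; rewrite rmorphM mu_delta mulr0.
have surj_r : surjective r by move=> b; exists (p (i b)); rewrite rE mui.
have sq0 y z : r y = 0 -> r z = 0 -> y * z = 0.
  have [y' <-] := surj_p y; have [z' <-] := surj_p z; rewrite !rE => my mz.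
  have [c ->] := kernel_mul mz; rewrite -rmorphM; apply/ker_p.
  exists (fun l => y' * c l) => [|l]; last by rewrite rmorphM my mul0r.
  by rewrite mulr_sumr; apply: eq_bigr => l _; rewrite mulrA.
have [ij _ _] := tensT.
have ijE : p \o i =1 p \o j.
  apply: (unr surj_r sq0) => [a|b] /=; first by rewrite ij.
  by rewrite !rE mui muj.
apply/ker_p; rewrite rmorphB; apply/eqP; rewrite subr_eq0.
exact/eqP/ijE.
Qed.

(** The determinant trick: delta = U delta for a matrix U with entries in the
    kernel of mu, so det (1 - U) annihilates every delta h, while mu sends it
    to det 1 = 1. *)
Lemma ex_separability_element : exists e : T,
  mu e = 1 /\ forall z, mu z = 0 -> e * z = 0.
Proof.
have exU h : exists u : 'I_n -> T,
    delta h = \sum_(l < n) u l * delta l /\ forall l, mu (u l) = 0.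
  by have [u ? ?] := kernel_mul_square h; exists u.
have [U UE] := choice exU.
pose M := 1%:M - \matrix_(h < n, l < n) U h l.
exists (\det M); split.
  rewrite -det_map_mx -(det1 B n); congr (\det _); apply/matrixP => h l.
  by rewrite !mxE rmorphB (UE h).2 subr0 rmorph_nat.
have Md0 : M *m (\col_h delta h) = 0.
  apply/colP => h; rewrite mulmxBl mul1mx !mxE {1}(UE h).1.
  by apply/eqP; rewrite subr_eq0; apply/eqP; apply: eq_bigr => l _;
    rewrite !mxE.
have detd h : \det M * delta h = 0.
  have := congr1 (fun N : 'cV_n => (\adj M *m N) h 0) Md0.
  by rewrite mulmxA mul_adj_mx mulmx0 mul_scalar_mx !mxE.
move=> z /kernel_mul [c ->]; rewrite mulr_sumr big1 // => h _.
by rewrite mulrCA detd mulr0.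
Qed.

End SeparabilityElement.

Lemma unramified_surjective (k L : fieldType) (psi : {rmorphism k -> L})
    n (x : 'I_n -> L) :
    separably_closed k -> formally_unramified psi -> generated_by psi x ->
  surjective psi.
Proof.
move=> sep_k unr gen_x; have [T [i [j tensT]]] := ex_tensor_ring psi psi.
have [|mu [mui muj]] := tensor_ring_pushout tensT (v := idfun) (w := idfun).
  by [].
have [e [mue eJ]] := ex_separability_element tensT mui muj gen_x unr.
have eE y : e * i y = e * j y.
  apply/eqP; rewrite -subr_eq0 -mulrBr; apply/eqP/eJ.
  by rewrite rmorphB mui muj subrr.
have e0 : e <> 0.
  by move=> e0; move/eqP: mue; rewrite e0 rmorph0 eq_sym oner_eq0.
have nil_delta y : nilpotent (i y - j y).
  have [p p0 py] := algebraic_of_separability_element tensT e0 eE y.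
  exact: (algebraic_nilpotent tensT sep_k (leqnn _) p0 py).
have mu1e : mu (1 - e) = 0 by rewrite rmorphB mue rmorph1 subrr.
have [m me0] : nilpotent (1 - e).
  have [I0 ID IM] := nilpotent_is_ideal T.
  have [c ->] := kernel_mul tensT mui muj gen_x mu1e.
  by elim/big_ind: _ => // h _; exact: IM.
(* The element 1 - e lies in the kernel of mu, so e (1 - e) = 0. *)
have idem l : (1 - e) ^+ l.+1 = 1 - e.
  elim: l => [|l IH]; first exact: expr1.
  by rewrite exprS IH mulrBl mul1r (eJ _ mu1e) subr0.
have e1 : e = 1.
  by apply/eqP; rewrite eq_sym -subr_eq0 -(idem m) exprS me0 mulr0.
move=> y; apply: (tensor_fst_eq_snd tensT).
by have := eE y; rewrite e1 !mul1r.
Qed.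

(** The residue field L of any maximal ideal of B is unramified and of finite
    type over k, hence equal to k, and B -> L is a retraction. *)
Lemma separably_closed_point (k : fieldType) :
  separably_closed k -> is_point (@etale) k.
Proof.
move=> sep_k; split; first by apply/eqP; exact: oner_neq0.
move=> B phi [_ unr fp] B0.
have [n maxn] := ex_maximal_ideal B0.
have [L [pi [surj_pi _]]] := ex_residue_field maxn.
have [d [x gen_x]] := finitely_presented_generated fp.
pose psi : {rmorphism k -> L} := pi \o phi.
have surj_psi : surjective psi.
  apply: (@unramified_surjective k L psi d (pi \o x)) => //.
  - move=> C D p surj_p sq0 g h gh pgh y; have [b <-] := surj_pi y.
    apply: (unr C D p surj_p sq0 (g \o pi) (h \o pi)) => [a|b'].
      exact: gh.
    exact: pgh.
  - move=> C g h gh ghx y; have [b <-] := surj_pi y.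
    exact: (gen_x C (g \o pi) (h \o pi)).
have [|r rE] := quotient_factor (f := idfun) surj_psi.
  by move=> c /eqP; rewrite fmorph_eq0 => /eqP.
by exists (r \o pi) => c; exact: rE.
Qed.

Lemma kernel_maximal_ideal (B : comPzRingType) (k : fieldType)
    (v : {rmorphism B -> k}) :
  surjective v -> maximal_ideal (fun b => v b = 0).
Proof.
move=> surj_v; split.
- split=> [|b c vb vc|b c vc]; first exact: rmorph0.
    by rewrite rmorphD vb vc addr0.
  by rewrite rmorphM vc mulr0.
- by rewrite rmorph1; apply/eqP; exact: oner_neq0.
move=> J [J0 JD JM] J1 kerJ b Jb; apply: contrapT => /eqP vb.
have [c vc] := surj_v (v b)^-1; apply: J1.
rewrite -(subrK (c * b) 1); apply: JD; last exact: JM.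
by apply: kerJ; rewrite rmorphB rmorphM rmorph1 vc mulVf // subrr.
Qed.

Lemma strictly_henselian_local_object (A : comPzRingType) (m : A -> Prop) :
  strictly_henselian m -> local_object (@etale) A.
Proof.
case=> [[_ hens]] [k [pi [[surj_pi ker_pi] sep_k]]] I A_ f [et cov].
have [i [v vE]] := cov k pi (separably_closed_point sep_k).
exists i; apply: hens => //; exists (fun b => v b = 0).
have surj_v : surjective v.
  by move=> c; have [a <-] := surj_pi c; exists (f i a).
split; first exact: kernel_maximal_ideal.
  by move=> a; rewrite vE.
move=> b; have [a ab] := surj_pi (v b).
by exists a; rewrite rmorphB vE ab subrr.
Qed.

Theorem proposition73 (A : comPzRingType) :
  local_object etale A <->
  exists m : A -> Prop, strictly_henselian m.
Proof.
split; first exact: local_object_strictly_henselian.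
by case=> m; exact: strictly_henselian_local_object.
Qed.
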